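(* Let $n\in\mathbb{R}^+\cup\{0\}$, $f\in D_{HK}$, and let $F\in C_0$ be the primitive of $f$. Then $$\mathcal{J}_a^{n}f=D(\mathcal{J}_a^{n}F).$$ Consequently, for every $j\in\mathbb{N}$ and $\phi\in\mathcal{D}(a,b)$, $$\langle D^{j}(\mathcal{J}_a^{n}f),\phi\rangle=(-1)^{j+1}\langle\mathcal{J}_a^{n}F,\phi^{(j+1)}\rangle.$$ Moreover, with $m=\lceil n\rceil$, $\mathcal{D}^{n}_af=D^{m+1}\mathcal{J}_a^{m-n}F$. For $0<n<1$, $\mathcal{D}^n_aF$ is a temperate distribution and $\mathcal{D}^n_aF=\mathcal{J}_a^{1-n}f$.
   Context: Fix real numbers $a<b$. $\mathcal{D}(a,b)$ is the space of real $C^\infty$ functions with compact support in $(a,b)$, $\mathcal{D}'(a,b)$ the space of distributions on $(a,b)$, $\langle T,\phi\rangle$ the action of a distribution on a test function (for integrable $T$, $\langle T,\phi\rangle=\int_a^b T\phi$), $D$ the distributional derivative and $D^m$ its $m$-fold iterate. Let $C_0=\{F\in C[a,b]:F(a)=0\}$. A distribution $f\in\mathcal{D}'(a,b)$ is Henstock–Kurzweil integrable if there is $F\in C_0$ with $DF=f$ (such $F$ is unique, the primitive of $f$); its distributional Henstock–Kurzweil integral is $\int_c^d f=F(d)-F(c)$. $D_{HK}$ is the space of these distributions with the Alexiewicz norm $\|f\|_A=\sup_{x\in[a,b]}|F(x)|$; it is a Banach space containing $L^1[a,b]$ as a dense subspace and containing $C[a,b]$. Riemann–Liouville fractional integral on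 $D_{HK}$: for $n\ge 1$, $\mathcal{J}_a^nf(x)=\frac{1}{\Gamma(n)}\int_a^x(x-t)^{n-1}f(t)\,dt$ ($a\le x\le b$); for $0<n<1$, $\mathcal{J}_a^nf(x)=\frac{1}{\Gamma(n)}\lim_{k\to\infty}\int_a^x(x-t)^{n-1}f_k(t)\,dt$ with $(f_k)\subset L^1[a,b]$, $\|f_k-f\|_A\to0$; $\mathcal{J}_a^0=I$. Riemann–Liouville fractional derivative: for $n\ge0$ and $m=\lceil n\rceil$ (least integer $\ge n$), $\mathcal{D}_a^nf=D^m\mathcal{J}_a^{m-n}f\in\mathcal{D}'(a,b)$, $\mathcal{D}_a^0=I$. *)

(* Defs.v *)
From HB Require Import structures.
From mathcomp Require Import all_boot all_order all_algebra.
From mathcomp Require Import all_classical all_reals all_analysis.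
Set Implicit Arguments. Unset Strict Implicit. Unset Printing Implicit Defensive.
Import Order.TTheory GRing.Theory Num.Theory.
Import numFieldNormedType.Exports.
Local Open Scope classical_set_scope.
Local Open Scope ring_scope.

Section Defs.
Variable R : realType.
Local Notation mu := (@lebesgue_measure R).

Definition integ (A : set R) (g : R -> R) : R := Rintegral mu A g.

Definition Gamma (s : R) : R :=
  integ `]0, +oo[ (fun t => t `^ (s - 1) * expR (- t)).

Definition smooth (phi : R -> R) : Prop :=
  forall (k : nat) (x : R), derivable (derive1n k phi) x 1.

Definition test_fun (a b : R) (phi : R -> R) : Prop :=
  smooth phi /\
  exists c d : R, [/\ a < c, d < b &
    forall x, x < c \/ d < x -> phi x = 0].

(* distributions are represented by functionals <T, .> on R -> R; only their
   values on test functions matter.  Equality in D'(a,b): *)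
Definition eqD (a b : R) (T1 T2 : (R -> R) -> R) : Prop :=
  forall phi, test_fun a b phi -> T1 phi = T2 phi.

Definition reg (a b : R) (g : R -> R) : (R -> R) -> R :=
  fun phi => integ `]a, b[ (fun x => g x * phi x).

Definition Dd (T : (R -> R) -> R) : (R -> R) -> R :=
  fun phi => - T (derive1n 1 phi).

Definition Dn (m : nat) (T : (R -> R) -> R) : (R -> R) -> R := iter m Dd T.

Definition primitive (a b : R) (f : (R -> R) -> R) (F : R -> R) : Prop :=
  [/\ {within `[a, b], continuous F}, F a = 0 & eqD a b (Dd (reg a b F)) f].

Definition HK (a b : R) (f : (R -> R) -> R) : Prop :=
  exists F, primitive a b f F.

Definition L1 (a b : R) (g : R -> R) : Prop :=
  mu.-integrable `[a, b] (EFin \o g).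

Definition primL1 (a : R) (g : R -> R) : R -> R :=
  fun x => integ `[a, x] g.

(* uniform convergence on [a,b], i.e. convergence in the Alexiewicz norm of
   the corresponding elements of D_HK when G k, Q are primitives *)
Definition unif_cvg (a b : R) (G : nat -> R -> R) (Q : R -> R) : Prop :=
  forall eps : R, 0 < eps -> exists N : nat, forall k : nat, (N <= k)%N ->
    forall x, a <= x <= b -> `|G k x - Q x| <= eps.

Definition RL_L1 (a n : R) (g : R -> R) : R -> R :=
  fun x => (Gamma n)^-1 * integ `[a, x] (fun t => (x - t) `^ (n - 1) * g t).

(* For n >= 1 and f in D_HK with primitive P:
   J^n f (x) = 1/Gamma(n) int_a^x (x-t)^(n-1) f(t) dt, where the HK integral of
   f times the (absolutely continuous, monotone) function g(t) = (x-t)^(n-1)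
   is, by definition, P(x)g(x) - P(a)g(a) - int_a^x P dg, and
   dg = -(n-1)(x-t)^(n-2) dt. *)
Definition RL_HK_ge1 (a n : R) (P : R -> R) : R -> R :=
  fun x => (Gamma n)^-1 *
    (0 `^ (n - 1) * P x - (x - a) `^ (n - 1) * P a
     + (n - 1) * integ `[a, x] (fun t => (x - t) `^ (n - 2) * P t)).

Definition isRL (a b n : R) (f : (R -> R) -> R) (T : (R -> R) -> R) : Prop :=
  forall P, primitive a b f P ->
  if n == 0 then eqD a b T f
  else if 1 <= n then eqD a b T (reg a b (RL_HK_ge1 a n P))
  else (* 0 < n < 1 : limit in D_HK (Alexiewicz norm) *)
    exists Q, primitive a b T Q /\
      forall fk : nat -> R -> R,
        (forall k, L1 a b (fk k)) ->
        unif_cvg a b (fun k => primL1 a (fk k)) P ->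
        unif_cvg a b (fun k => primL1 a (RL_L1 a n (fk k))) Q.

Definition ceiln (n : R) : nat := `|Num.ceil n|%N.

Definition isRLder (a b n : R) (f : (R -> R) -> R) (T : (R -> R) -> R) : Prop :=
  exists T', isRL a b ((ceiln n)%:R - n) f T' /\ eqD a b T (Dn (ceiln n) T').

Definition schwartz (phi : R -> R) : Prop :=
  smooth phi /\ forall i j : nat, exists M : R, forall x,
    `|x ^+ i * derive1n j phi x| <= M.

Definition tempered (S : (R -> R) -> R) : Prop :=
  (forall phi psi (c : R), schwartz phi -> schwartz psi ->
     S (fun x => c * phi x + psi x) = c * S phi + S psi) /\
  exists (C : R) (N : nat), forall phi, schwartz phi ->
    forall M : R, (forall (i j : nat) x, (i <= N)%N -> (j <= N)%N ->
                     `|x ^+ i * derive1n j phi x| <= M) ->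
    `|S phi| <= C * M.

Definition temperate_on (a b : R) (T : (R -> R) -> R) : Prop :=
  exists S, tempered S /\ eqD a b S T.

End Defs.

(* Main.v *)
(* Let K_s g (x) be the integral of (x - t)^(s-1) g(t) over [a, x], and J the
   plain primitive.  Fubini on the triangle a <= t <= u <= x gives
   J (K_s g) = K_s (J g) for integrable g: both are the integral of
   (x - t)^s / s * g(t).  The two sides of the theorem carry the same Gamma
   factor, so its functional equation is never needed.  For 0 < n < 1, K_n is
   bounded for the sup norm, hence the primitives J (K_n f_k) = K_n (J f_k)
   converge uniformly to K_n F as soon as J f_k converges to F; Steklov
   averages provide such f_k, so J^n f has primitive J^n F.  For n >= 1 the
   definition of J^n f is a multiple of K_(n-1) F (or of F), and the same
   commutation applies.  The du Bois-Reymond lemma shows that the construction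
   depends on f only.  Finally D^n F = J^(1-n) f is the derivative of a
   continuous function on [a, b], extended by 0 to a temperate distribution. *)
Require Import Defs.
From HB Require Import structures.
From mathcomp Require Import all_boot all_order all_algebra.
From mathcomp Require Import all_classical all_reals all_analysis.
From mathcomp Require Import measurable_realfun ring lra.
Import Order.TTheory GRing.Theory Num.Theory.
Import numFieldNormedType.Exports.
Local Open Scope classical_set_scope.
Local Open Scope ring_scope.

(** * Integrals of powers with a singular end point *)

Section power_integrals.
Context {R : realType}.
Local Notation mu := (@lebesgue_measure R).
Implicit Types (a b x : R).

(* f may be unbounded near p and q: exhaust ]p, q[ by closed intervals and use
   monotone convergence. *)
Lemma ge0_integral_FTC_oo (f F : R -> R) (p q : R) : p < q ->
  (forall x, p < x < q -> 0 <= f x) ->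
  (forall x, p < x < q -> {for x, continuous f}) ->
  (forall x, p < x < q -> is_derive x 1 F (f x)) ->
  F x @[x --> p^'+] --> F p -> F x @[x --> q^'-] --> F q ->
  (\int[mu]_(x in `]p, q[) (f x)%:E = (F q - F p)%:E)%E.
Proof.
move=> pq f0 cf dF Fp Fq.
(* The factor (q - p) / 3 keeps p + e k below q - e k, so every interval I k is nondegenerate. *)
pose e (k : nat) : R := (q - p) / 3 * k.+1%:R^-1.
have e_gt0 k : 0 < e k by rewrite /e mulr_gt0 ?invr_gt0 ?divr_gt0 ?subr_gt0.
have e_le k : e k <= (q - p) / 3.
  have h : (k.+1%:R^-1 : R) <= 1 by rewrite invr_le1 ?unitfE// ler1n.
  have h0 : 0 <= (q - p) / 3 by lra.
  by rewrite /e; have := ler_wpM2l h0 h; rewrite mulr1.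
have ecvg : e k @[k --> \oo] --> (0 : R).
  rewrite -[X in _ --> X](mulr0 ((q - p) / 3)); apply: cvgMr.
  exact: cvg_harmonic.
have Iin k x : x \in `[p + e k, q - e k] -> p < x < q.
  by rewrite in_itv/= => /andP[]; have := e_gt0 k; lra.
pose I k := `[p + e k, q - e k]%classic.
have cupI : \bigcup_k I k = `]p, q[%classic.
  apply/seteqP; split => [x [k _] /Iin /=|x /=]; rewrite ?in_itv//= => /andP[px xq].
  have : \forall k \near \oo, e k < Num.min (x - p) (q - x).
    have : 0 < Num.min (x - p) (q - x) by rewrite lt_min !subr_gt0 px xq.
    by move: ecvg => /cvgrPdist_lt/(_ _) /[apply]; apply: filterS => k;
      rewrite sub0r normrN gtr0_norm.
  case=> k _ /(_ k (leqnn k)); rewrite lt_min => /andP[h1 h2]; exists k => //.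
  by rewrite /I/= in_itv/=; lra.
have cfI k : {within I k, continuous f}.
  apply: continuous_in_subspaceT => x /set_mem /Iin; exact: cf.
have mfI k : measurable_fun (I k) f.
  by apply: subspace_continuous_measurable_fun; [exact: measurable_itv|exact: cfI].
have intI k : (\int[mu]_(x in I k) (f x)%:E = (F (q - e k) - F (p + e k))%:E)%E.
  have cF x : p < x < q -> {for x, continuous F}.
    move=> /dF dFx; apply: differentiable_continuous.
    exact/derivable1_diffP/ex_derive.
  rewrite (@continuous_FTC2 _ f F)// ?EFinB//.
  - by have := e_le k; have := e_gt0 k; move: pq; lra.
  - exact: cfI.
  - split=> [x||].
    + by move=> /subset_itv_oo_cc /Iin /dF hh; exact: (@ex_derive _ _ _ _ _ _ _ hh).
    + by apply: cvg_at_right_filter; apply: cF; have := e_le k; have := e_gt0 k; move: pq; lra.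
    + by apply: cvg_at_left_filter; apply: cF; have := e_le k; have := e_gt0 k; move: pq; lra.
  - move=> x /subset_itv_oo_cc /Iin /dF xx.
    by rewrite derive1E derive_val.
have cvg1 : (\int[mu]_(x in I k) (f x)%:E @[k --> \oo] -->
             \int[mu]_(x in \bigcup_k I k) (f x)%:E)%E.
  apply: ge0_nondecreasing_set_cvg_integral => [k l kl|k|k|k x Ikx].
  - have ekl : e l <= e k.
      apply: ler_wpM2l; first by rewrite divr_ge0// subr_ge0 ltW.
      by rewrite lef_pV2 ?posrE// ler_nat.
    by rewrite subsetEset; apply: subset_itv; rewrite bnd_simp; move: ekl; lra.
  - exact: measurable_itv.
  - by apply/measurable_EFinP; exact: mfI.
  - by rewrite lee_fin; apply/f0/Iin/Ikx.
have cvg2 : ((F (q - e k) - F (p + e k))%:E @[k --> \oo] --> (F q - F p)%:E)%E.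
  apply: cvg_EFin; first exact: nearW.
  apply: cvgB.
  - move/cvg_at_leftP : Fq; apply; split=> [k|]; first by rewrite ltrBlDr ltrDl.
    by rewrite -[X in _ --> X]subr0; apply: cvgB => //; exact: cvg_cst.
  - move/cvg_at_rightP : Fp; apply; split=> [k|]; first by rewrite ltrDl.
    by rewrite -[X in _ --> X]addr0; apply: cvgD => //; exact: cvg_cst.
move: cvg1; under eq_fun do rewrite intI.
rewrite cupI => cvg1.
exact: (cvg_unique _ cvg1 cvg2).
Qed.

Lemma ge0_integral_FTC_cc (f F : R -> R) (p q : R) : p < q ->
  measurable_fun `[p, q] f ->
  (forall x, p < x < q -> 0 <= f x) ->
  (forall x, p < x < q -> {for x, continuous f}) ->
  (forall x, p < x < q -> is_derive x 1 F (f x)) ->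
  F x @[x --> p^'+] --> F p -> F x @[x --> q^'-] --> F q ->
  (\int[mu]_(x in `[p, q]) (f x)%:E = (F q - F p)%:E)%E.
Proof.
move=> pq mf f0 cf dF Fp Fq.
rewrite -(@ge0_integral_FTC_oo f)// -integral_itv_obnd_cbnd ?integral_itv_bndo_bndc//.
- by apply/measurable_EFinP; apply: measurable_funS mf => //; exact: subset_itv_oo_cc.
- by apply/measurable_EFinP; apply: measurable_funS mf => //; exact: subset_itv_oc_cc.
Qed.

Lemma is_derive1_continuous (f : R -> R) (x df : R) :
  is_derive x 1 f df -> {for x, continuous f}.
Proof.
move=> dfx; apply: differentiable_continuous.
by apply/derivable1_diffP/(@ex_derive _ _ _ _ _ _ _ dfx).
Qed.

Lemma is_derive_powR_subr (s t x : R) : 0 < s -> t < x ->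
  is_derive x 1 (fun u => (u - t) `^ s / s) ((x - t) `^ (s - 1)).
Proof.
move=> s0 tx.
have dp : is_derive (x - t) 1 (@powR R ^~ s) (s * (x - t) `^ (s - 1)).
  by apply: is_derive1_powR; rewrite subr_gt0.
have ds : is_derive x 1 (fun u : R => u - t) 1.
  by apply: is_derive_eq; rewrite subr0.
have dc := @is_derive1_comp R (@powR R ^~ s) (fun u => u - t) _ _ _ dp ds.
have dm := is_deriveM dc (is_derive_cst s^-1 x 1).
apply: (is_derive_eq dm).
by rewrite scaler0 add0r mulr1 /= /GRing.scale /= mulrA mulVf ?gt_eqF// mul1r.
Qed.

Lemma is_derive_powR_rsub (s t x : R) : 0 < s -> t < x ->
  is_derive t 1 (fun u => - ((x - u) `^ s / s)) ((x - t) `^ (s - 1)).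
Proof.
move=> s0 tx.
have dp : is_derive (x - t) 1 (@powR R ^~ s) (s * (x - t) `^ (s - 1)).
  by apply: is_derive1_powR; rewrite subr_gt0.
have ds : is_derive t 1 (fun u : R => x - u) (- 1).
  by apply: is_derive_eq; rewrite add0r mul1r.
have dc := @is_derive1_comp R (@powR R ^~ s) (fun u => x - u) _ _ _ dp ds.
have dm := is_deriveN (is_deriveM dc (is_derive_cst s^-1 t 1)).
apply: (is_derive_eq dm).
rewrite scaler0 add0r mulrN1 /= /GRing.scale /= mulrN opprK.
by rewrite mulrA mulVf ?gt_eqF// mul1r.
Qed.

(** For s < 1 the integrand blows up at t, but its antiderivative (u - t)^s / s stays continuous
    there because s > 0. *)
Lemma integral_powR_subr (t x s : R) : t <= x -> 0 < s ->
  (\int[mu]_(u in `[t, x]) ((u - t) `^ (s - 1))%:E = ((x - t) `^ s / s)%:E)%E.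
Proof.
rewrite le_eqVlt => /predU1P[<-|tx] s0.
  by rewrite set_itv1 integral_set1 subrr powR0 ?gt_eqF// mul0r.
have -> : (x - t) `^ s / s = (x - t) `^ s / s - (t - t) `^ s / s.
  by rewrite subrr powR0 ?gt_eqF// mul0r subr0.
apply: (@ge0_integral_FTC_cc _ (fun u => (u - t) `^ s / s)) => //.
- apply: (measurableT_comp (@measurable_powR R (s - 1))).
  by apply: measurable_funB => //.
- by move=> u _; exact: powR_ge0.
- move=> u /andP[tu _].
  apply: (@continuous_comp _ _ _ (fun u => u - t) (@powR R ^~ (s - 1))).
  + by apply: (@continuousB _ _ _ id (cst t)) => //; exact: cvg_cst.
  + apply: (is_derive1_continuous _ _ _ (is_derive1_powR _ _)); rewrite subr_gt0//.
- by move=> u /andP[tu _]; exact: is_derive_powR_subr.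
- apply/cvg_at_rightP => u [ut cu].
  rewrite subrr; apply: cvgMl.
  have /cvg_at_rightP := powR_cvg0 s0.
  rewrite powR0 ?gt_eqF//; apply; split=> [k|]; first by rewrite subr_gt0.
  by rewrite -[X in _ --> X](subrr t); apply: cvgB => //; exact: cvg_cst.
- apply: cvg_at_left_filter.
  exact: (is_derive1_continuous _ _ _ (is_derive_powR_subr _ _ _ s0 tx)).
Qed.

(** Mirror image of the previous computation: the singularity sits at the upper end point, and the
    antiderivative is - (x - u)^s / s. *)
Lemma integral_powR_rsub (t x s : R) : t <= x -> 0 < s ->
  (\int[mu]_(u in `[t, x]) ((x - u) `^ (s - 1))%:E = ((x - t) `^ s / s)%:E)%E.
Proof.
rewrite le_eqVlt => /predU1P[<-|tx] s0.
  by rewrite set_itv1 integral_set1 subrr powR0 ?gt_eqF// mul0r.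
have -> : (x - t) `^ s / s = - ((x - x) `^ s / s) - - ((x - t) `^ s / s).
  by rewrite subrr powR0 ?gt_eqF// mul0r oppr0 sub0r opprK.
apply: (@ge0_integral_FTC_cc _ (fun u => - ((x - u) `^ s / s))) => //.
- apply: (measurableT_comp (@measurable_powR R (s - 1))).
  by apply: measurable_funB => //.
- by move=> u _; exact: powR_ge0.
- move=> u /andP[_ ux].
  apply: (@continuous_comp _ _ _ (fun u => x - u) (@powR R ^~ (s - 1))).
  + by apply: (@continuousB _ _ _ (cst x) id) => //; exact: cvg_cst.
  + apply: (is_derive1_continuous _ _ _ (is_derive1_powR _ _)); rewrite subr_gt0//.
- by move=> u /andP[_ ux]; exact: is_derive_powR_rsub.
- apply: cvg_at_right_filter.
  exact: (is_derive1_continuous _ _ _ (is_derive_powR_rsub _ _ _ s0 tx)).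
- apply/cvg_at_leftP => u [ux cu].
  rewrite subrr; apply: cvgN; apply: cvgMl.
  have /cvg_at_rightP := powR_cvg0 s0.
  rewrite powR0 ?gt_eqF//; apply; split=> [k|]; first by rewrite subr_gt0.
  by rewrite -[X in _ --> X](subrr x); apply: cvgB => //; exact: cvg_cst.
Qed.

End power_integrals.

(** * Exchange of integrals over a triangle *)

Section triangle_fubini.
Context {R : realType}.
Local Notation mu := (@lebesgue_measure R).
Implicit Types (a b x : R).

(* The inner integral may diverge for s in a null set, where its value as a real
   number is junk. *)
Lemma triangle_Fubini (a x C : R) (w : R -> R -> R) (c g : R -> R) :
  measurable_fun setT (fun z : R * R => w z.1 z.2) ->
  (forall s t, 0 <= w s t) ->
  (forall t, a <= t <= x -> (\int[mu]_(s in `[t, x]) (w s t)%:E = (c t)%:E)%E) ->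
  (forall t, a <= t <= x -> c t <= C) ->
  mu.-integrable `[a, x] (EFin \o g) ->
  mu.-integrable `[a, x] (EFin \o (fun s => integ `[a, s] (fun t => w s t * g t)))
  /\ integ `[a, x] (fun s => integ `[a, s] (fun t => w s t * g t)) =
     integ `[a, x] (fun t => c t * g t).
Proof.
move=> mw w0 wc cC ig.
pose D : set R := `[a, x]%classic.
have mD : measurable D by exact: measurable_itv.
have inD t : (t \in D) = (a <= t <= x) by rewrite /D mem_setE in_itv.
pose g0 := g \_ D.
have ig0 : mu.-integrable setT (EFin \o g0).
  by rewrite -restrict_EFin; apply/integrable_restrict => //; rewrite setTI.
have mg0 : measurable_fun setT g0 by apply/measurable_EFinP; case/integrableP : ig0.
(* The integrand is extended by 0 from the triangle to the whole plane; the bound a <= t is enforced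
   by g0. *)
pose h (z : R * R) : R :=
  if (z.2 <= z.1) && (z.1 <= x) then w z.1 z.2 * g0 z.2 else 0.
pose H z := (h z)%:E.
have mb : measurable_fun setT (fun z : R * R => (z.2 <= z.1) && (z.1 <= x)).
  by apply: measurable_and; apply: measurable_fun_ler => //.
have mh : measurable_fun setT h.
  apply: measurable_fun_ifT => //.
  by apply: measurable_funM => //; exact: measurableT_comp mg0 _.
have mH : measurable_fun setT H by exact/measurable_EFinP.
have mwt t A : measurable_fun A (fun s => w s t).
  apply: measurable_funTS.
  exact: (measurable_fun_pair1 t mw).
have absH t : (\int[mu]_s `|H (s, t)| = (c t * `|g0 t|)%:E)%E.
  have [tD|tD] := boolP (t \in D); last first.
    rewrite integral0_eq; first by rewrite /g0 patchN// normr0 mulr0.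
    by move=> s _; rewrite /H/h/= /g0 patchN//; case: ifP; rewrite ?mulr0/= normr0.
  have atx : a <= t <= x by rewrite -inD.
  rewrite EFinM -wc// -ge0_integralZr//; last 2 first.
    - apply/measurable_EFinP.
      exact: mwt.
    - by move=> s _; rewrite lee_fin.
  rewrite [RHS]integral_mkcond; apply: eq_integral => s _.
  rewrite /H/h/= patchE. 
  rewrite mem_setE in_itv/=; case: ifP => _; last by rewrite /= normr0.
  by rewrite /= normrM (ger0_norm (w0 _ _)).
(* Tonelli: integrating over s first bounds the integral of |H| by |C| times the integral of
   |g0|. *)
have iH : (mu \x mu)%E.-integrable setT H.
  apply/integrable21ltyP => //.
  apply: (@le_lt_trans _ _ (\int[mu]_t (`|C|%:E * `|(g0 t)%:E|))%E).
    apply: ge0_le_integral => //.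
    - by move=> t _; exact: integral_ge0.
    - have mabsH : measurable_fun setT (abse \o H) by exact: measurableT_comp.
      apply: (@measurable_fun_fubini_tonelli_G _ _ _ _ _ mu _ mabsH) => z; exact: abse_ge0.
    - apply: measurable_funeM; apply: measurableT_comp => //.
      exact/measurable_EFinP.
    - move=> t _; rewrite absH /= lee_fin.
      have [tD|tD] := boolP (t \in D); last by rewrite /g0 patchN// normr0 !mulr0.
      apply: ler_wpM2r => //; apply: (le_trans (cC t _)); last by rewrite ler_norm.
      by rewrite -inD.
  rewrite ge0_integralZl//; last first.
    by apply: measurableT_comp => //; exact/measurable_EFinP.
  case/integrableP : ig0 => _ ig0.
  by rewrite lte_mul_pinfty// lee_fin.
have HE s : s \in D -> (\int[mu]_t H (s, t) = \int[mu]_(t in `[a, s]) (w s t * g t)%:E)%E.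
  rewrite inD => /andP[as_ sx].
  rewrite [RHS]integral_mkcond; apply: eq_integral => t _.
  rewrite /H/h/= patchE mem_setE in_itv/= sx andbT /g0 patchE inD.
  have [ts|] := leP t s; last by rewrite andbF.
  by rewrite (le_trans ts sx) !andbT; case: ifP => //; rewrite mulr0.
have HE0 s : s \notin D -> (\int[mu]_t H (s, t) = 0)%E.
  move=> sD; rewrite integral0_eq// => t _; rewrite /H/h/=.
  case: ifP => // /andP[ts sx]; rewrite /g0 patchE inD.
  case: ifP; rewrite ?mulr0// => /andP[at_ tx]; move: sD.
  by rewrite inD sx (le_trans at_ ts).
have GE t : (\int[mu]_s H (s, t) = ((fun t => c t * g t) \_ D t)%:E)%E.
  have [tD|tD] := boolP (t \in D); last first.
    rewrite patchN// integral0_eq// => s _; rewrite /H/h/= /g0 patchN//.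
    by case: ifP; rewrite ?mulr0.
  rewrite patchT//.
  have atx : a <= t <= x by rewrite -inD.
  rewrite EFinM -wc// -integralZr//; last first.
    apply/integrableP; split; first by apply/measurable_EFinP; exact: mwt.
    under eq_integral do rewrite /= ger0_norm//.
    by rewrite wc// ltry.
  rewrite [RHS]integral_mkcond; apply: eq_integral => s _.
  rewrite /H/h/= patchE mem_setE in_itv/= /g0 patchT//.
  by case: ifP.
pose F s := (\int[mu]_t H (s, t))%E.
have iF : mu.-integrable setT F by exact: (integrable_fubini_F iH).
have mF : measurable_fun setT F by case/integrableP : iF.
have ifF : mu.-integrable D (fun s => (fine (F s))%:E).
  apply: (@le_integrable _ _ _ mu D mD _ F); last first.
  - exact: integrableS iF.
  - move=> s _; rewrite /= -/(F s).
    by case: (F s) => [r| |]//=; rewrite ?normr0 leey.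
  - apply/measurable_EFinP; apply: measurable_funTS.
    exact: (measurableT_comp (fine_measurable measurableT) mF).
have fE s : s \in D -> fine (F s) = integ `[a, s] (fun t => w s t * g t).
  by move=> sD; rewrite /F HE.
split.
  apply: (@eq_integrable _ _ _ mu D mD (fun s => (fine (F s))%:E)) => // s sD.
  by rewrite /= -fE.
have FU := Fubini iH.
rewrite /integ /Rintegral; congr fine.
transitivity (\int[mu]_(s in D) (fine (F s))%:E)%E.
  by apply: eq_integral => s sD; rewrite fE.
(* F is integrable, hence finite almost everywhere, so removing [fine] changes the integrand on a
   null set only. *)
transitivity (\int[mu]_(s in D) F s)%E.
  apply: ae_eq_integral; first exact: mD.
  - by case/integrableP : ifF.
  - exact: measurable_funTS.
  - have := integrable_ae measurableT iF; apply: filterS => s /(_ I) Fs _.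
    by rewrite fineK.
transitivity (\int[mu]_s F s)%E.
  rewrite integral_mkcond; apply: eq_integral => s _.
  have [sD|sD] := boolP (s \in D); first by rewrite patchT.
  by rewrite patchN// /F HE0.
rewrite /F FU integral_mkcond.
by apply: eq_integral => t _; rewrite GE !patchE; case: ifP.
Qed.
End triangle_fubini.

(** * The power kernel: commutation with the primitive and sup-norm bound *)

Section power_kernel.
Context {R : realType}.
Local Notation mu := (@lebesgue_measure R).
Implicit Types (a b x s : R).

(** This is K_s, the fractional integral of order s stripped of its Gamma factor. *)
Definition powint a s (g : R -> R) : R -> R :=
  fun x => integ `[a, x] (fun t => (x - t) `^ (s - 1) * g t).

Lemma powR_kernel_bound a x s t : 0 < s -> a <= t <= x ->
  (x - t) `^ s / s <= (x - a) `^ s / s.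
Proof.
move=> s0 /andP[at_ tx].
apply: ler_wpM2r; first by rewrite invr_ge0 ltW.
by apply: ge0_ler_powR; rewrite ?nnegrE; move: s0 at_ tx; lra.
Qed.

(** [triangle_Fubini] is used twice, with the kernels (u - t)^(s-1) and (x - u)^(s-1). Both have
    mass (x - t)^s / s over [t, x], so both iterated integrals reduce to the same single integral;
    the second kernel is free of t and leaves the inner integral. *)
Lemma primL1_powint a x s (g : R -> R) : 0 < s ->
  mu.-integrable `[a, x] (EFin \o g) ->
  mu.-integrable `[a, x] (EFin \o powint a s g) /\
  primL1 a (powint a s g) x = powint a s (primL1 a g) x.
Proof.
move=> s0 ig.
have [i1 e1] := @triangle_Fubini R a x ((x - a) `^ s / s)
  (fun u t => (u - t) `^ (s - 1)) (fun t => (x - t) `^ s / s) g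
  ltac:(apply: (measurableT_comp (@measurable_powR R (s - 1))); exact: measurable_funB)
  (fun u t => powR_ge0 _ _)
  ltac:(by move=> t /andP[_ tx]; exact: integral_powR_subr)
  (fun t => @powR_kernel_bound a x s t s0) ig.
have [_ e2] := @triangle_Fubini R a x ((x - a) `^ s / s)
  (fun u _ => (x - u) `^ (s - 1)) (fun t => (x - t) `^ s / s) g
  ltac:(apply: (measurableT_comp (@measurable_powR R (s - 1))); exact: measurable_funB)
  (fun u t => powR_ge0 _ _)
  ltac:(by move=> t /andP[_ tx]; exact: integral_powR_rsub)
  (fun t => @powR_kernel_bound a x s t s0) ig.
split; first exact: i1.
rewrite [LHS]e1 -[LHS]e2.
apply: eq_Rintegral => t; rewrite inE/= in_itv/= => /andP[_ tx].
rewrite [LHS]RintegralZl//.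
by apply: integrableS ig => //; apply: subset_itvl; rewrite bnd_simp.
Qed.

Lemma powker_integrable a x s : a <= x -> 0 < s ->
  mu.-integrable `[a, x] (EFin \o (fun t => (x - t) `^ (s - 1))).
Proof.
move=> ax s0; apply/integrableP; split.
  apply/measurable_EFinP; apply: measurable_funTS.
  by apply: (measurableT_comp (@measurable_powR R (s - 1))); exact: measurable_funB.
under eq_integral do rewrite /= ger0_norm ?powR_ge0//.
by rewrite integral_powR_rsub// ltry.
Qed.

Lemma powkerM_integrable a x s (M : R) (h : R -> R) : a <= x -> 0 < s ->
  measurable_fun `[a, x] h -> (forall t, a <= t <= x -> `|h t| <= M) ->
  mu.-integrable `[a, x] (EFin \o (fun t => (x - t) `^ (s - 1) * h t)).
Proof.
move=> ax s0 mh hM.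
pose g t := (M%:E * ((x - t) `^ (s - 1))%:E)%E.
apply: (@le_integrable _ _ _ mu _ (measurable_itv _) _ g).
- apply/measurable_EFinP; apply: measurable_funM => //; apply: measurable_funTS.
  by apply: (measurableT_comp (@measurable_powR R (s - 1))); exact: measurable_funB.
- move=> t; rewrite /= in_itv/= => atx.
  rewrite lee_fin normrM [leRHS]normrM [leRHS]mulrC ler_wpM2l//.
  exact: (le_trans (hM _ atx) (ler_norm _)).
- by apply: integrableZl => //; exact: powker_integrable.
Qed.

(** The factor (x - a)^s / s is the total mass of the kernel. Applied to differences of primitives,
    this gives continuity of K_s for the Alexiewicz norm. *)
Lemma powint_bound a x s (M : R) (h : R -> R) : a <= x -> 0 < s ->
  measurable_fun `[a, x] h -> (forall t, a <= t <= x -> `|h t| <= M) ->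
  `|powint a s h x| <= M * ((x - a) `^ s / s).
Proof.
move=> ax s0 mh hM.
have ih := powkerM_integrable a x s M h ax s0 mh hM.
apply: (le_trans (le_normr_Rintegral _ ih)) => //.
have -> : (x - a) `^ s / s = integ `[a, x] (fun t => (x - t) `^ (s - 1)).
  by rewrite /integ /Rintegral integral_powR_rsub.
rewrite -RintegralZl//; last exact: powker_integrable.
apply: le_Rintegral => //.
- exact: (integrable_norm ih).
- apply: (@eq_integrable _ _ _ mu _ (measurable_itv _)
    (fun t => (M%:E * ((x - t) `^ (s - 1))%:E)%E)) => //.
  by apply: integrableZl => //; exact: powker_integrable.
- move=> t; rewrite /= in_itv/= => atx.
  by rewrite normrM ger0_norm ?powR_ge0// mulrC ler_wpM2r ?powR_ge0 ?hM.
Qed.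

Lemma powintB a x s (M N : R) (h k : R -> R) : a <= x -> 0 < s ->
  measurable_fun `[a, x] h -> (forall t, a <= t <= x -> `|h t| <= M) ->
  measurable_fun `[a, x] k -> (forall t, a <= t <= x -> `|k t| <= N) ->
  powint a s h x - powint a s k x = powint a s (h \- k) x.
Proof.
move=> ax s0 mh hM mk kN.
rewrite -[LHS]RintegralB//; last 2 first.
- exact: powkerM_integrable hM.
- exact: powkerM_integrable kN.
by apply: eq_Rintegral => t _; rewrite mulrBr.
Qed.

End power_kernel.

(** * Density of integrable functions in the Alexiewicz norm *)

Section steklov_averages.
Context {R : realType}.
Local Notation mu := (@lebesgue_measure R).
Implicit Types (a b x s : R) (f F : R -> R).

(** Composition with this projection onto [a, b] extends a function on the segment by its end values
    to the whole line. *)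
Definition clamp a b x : R := Num.max a (Num.min b x).

Lemma clamp_itv a b x : a <= b -> a <= clamp a b x <= b.
Proof. by move=> ab; rewrite /clamp le_max lexx/= ge_max ab ge_min lexx. Qed.

Lemma clamp_id a b x : a <= x <= b -> clamp a b x = x.
Proof. by move=> /andP[ax xb]; rewrite /clamp min_r// max_r. Qed.

Lemma clamp_le a b x : a <= b -> x <= a -> clamp a b x = a.
Proof.
by move=> ab xa; rewrite /clamp max_l// ge_min xa orbT.
Qed.

Lemma continuous_clamp a b : continuous (clamp a b).
Proof.
move=> x; apply: (@continuous_max _ _ (cst a) (fun y => Num.min b y)).
  exact: cst_continuous.
by apply: (@continuous_min _ _ (cst b) id); [exact: cst_continuous|exact: cvg_id].
Qed.

Lemma continuous_comp_clamp a b F : a <= b ->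
  {within `[a, b], continuous F} -> continuous (F \o clamp a b).
Proof.
move=> ab /subspace_continuousP cF x.
apply: (@cvg_comp _ _ _ (clamp a b) F _ (within `[a, b] (nbhs (clamp a b x)))).
  move=> A wA; suff : \forall y \near x, A (clamp a b y) by [].
  have h : \forall y \near x, `[a, b]%classic (clamp a b y) -> A (clamp a b y).
    exact: (continuous_clamp a b x _ wA).
  by apply: filterS h => y; apply; rewrite /= in_itv/=; exact: clamp_itv.
by apply: cF; rewrite /= in_itv/=; exact: clamp_itv.
Qed.

(** Compactness makes the local moduli of continuity uniform. Only x is confined to [a, b]: the
    averages also look at points y to the left of a. *)
Lemma Heine_segment f a b (e : R) : continuous f -> 0 < e ->
  exists2 d : R, 0 < d &
    forall x y, a <= x <= b -> `|x - y| <= d -> `|f x - f y| <= e.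
Proof.
move=> cf e0.
have /compact_near_coveringP cov := @segment_compact R a b.
have := cov R (0^'+) (fun d x => forall y, `|x - y| <= d -> `|f x - f y| <= e) _.
have cov1 : forall x, `[a, b]%classic x -> \forall x' \near x & d \near (0^'+ : set_system R),
   forall y, `|x' - y| <= d -> `|f x' - f y| <= e.
  move=> x _.
  have e20 : 0 < e / 2 by rewrite divr_gt0.
  have /cvgrPdist_le/(_ _ e20) [d /= d0 hd] := cf x.
  (* One half of d covers the move from x to x', the other the move from x' to y. *)
  exists (ball x (d / 2), [set u : R | u < d / 2]) => /=.
    split; first by apply: nbhsx_ballx; rewrite divr_gt0.
    by apply: nbhs_right_lt; rewrite divr_gt0.
  move=> [x' u] /= [x'x ud] y x'y.
  have xy : `|x - y| < d.
    by apply: (le_lt_trans (ler_distD x' x y)); move: x'x; rewrite /ball/=; lra.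
  have xx' : `|x - x'| < d by apply: (lt_trans x'x); lra.
  have := hd _ xy; have := hd _ xx'; rewrite (distrC (f x) (f x')).
  by have := ler_distD (f x) (f x') (f y); lra.
move=> /(_ _ cov1) [d /= d0 hd].
exists (d / 2); first by rewrite divr_gt0.
move=> x y xab; apply: (hd (d / 2)) => //=.
- by rewrite sub0r normrN gtr0_norm ?divr_gt0// ltr_pdivrMr// ltr_pMr// ltr1n.
- by rewrite divr_gt0.
Qed.

Lemma is_derive_integ f c x : continuous f -> c < x ->
  is_derive x 1 (fun y => integ `[c, y] f) (f x).
Proof.
move=> cf cx.
have [||] := @continuous_FTC1_closed R f c x (x + 1) _ _ cx (cf x).
- by rewrite ltrDl.
- apply: continuous_compact_integrable; first exact: segment_compact.
  exact: continuous_subspaceT.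
- by move=> d1 d2; apply: DeriveDef; [exact: d1|rewrite -derive1E; exact: d2].
Qed.

(* Steklov averages: with h = 1/(k+1) and F extended by constants, the
   primitive of (F x - F (x - h)) / h is the mean of F over [x - h, x]. *)
Lemma L1_dense_Alexiewicz a b F : a < b ->
  {within `[a, b], continuous F} -> F a = 0 ->
  exists fk : nat -> R -> R, (forall k, L1 a b (fk k)) /\
    unif_cvg a b (fun k => primL1 a (fk k)) F.
Proof.
move=> ab cF Fa.
pose f := F \o clamp a b.
have cf : continuous f by apply: continuous_comp_clamp => //; exact: ltW.
have fE x : a <= x <= b -> f x = F x by move=> xab; rewrite /f/= clamp_id.
have f0 x : x <= a -> f x = 0 by move=> xa; rewrite /f/= clamp_le// ltW.
pose h (k : nat) : R := k.+1%:R^-1.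
have h0 k : 0 < h k by rewrite invr_gt0.
have h1 k : h k <= 1 by rewrite invr_le1 ?unitfE// ler1n.
have cfh k : continuous (fun x => f (x - h k)).
  move=> x; apply: (@continuous_comp _ _ _ (fun x => x - h k) f); last exact: cf.
  by apply: (@continuousB _ _ _ id (cst (h k))) => //; exact: cvg_cst.
pose fk k x := (f x - f (x - h k)) / h k.
have cfk k : continuous (fk k).
  move=> x; apply: (@continuousM _ _ (fun x => f x - f (x - h k)) (cst (h k)^-1)).
    by apply: (@continuousB _ _ _ f); [exact: cf|exact: cfh].
  exact: cst_continuous.
exists fk; split=> [k|].
  apply: continuous_compact_integrable; first exact: segment_compact.
  exact/continuous_subspaceT/cfk.
(* Since h k <= 1, the base point a - 2 leaves both x and x - h k inside the domain of
   differentiability of Phi as soon as x > a - 1. *)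
pose Phi x := integ `[a - 2, x] f.
have dPhi x : a - 2 < x -> is_derive x 1 Phi (f x).
  exact: is_derive_integ.
pose Psi k x := (Phi x - Phi (x - h k)) / h k.
have dPsi k x : a - 1 < x -> is_derive x 1 (Psi k) (fk k x).
  move=> ax; have hk := h1 k.
  have d1 : is_derive x 1 Phi (f x) by apply: dPhi; move: ax; lra.
  have d2 : is_derive (x - h k) 1 Phi (f (x - h k)) by apply: dPhi; move: ax; lra.
  have d3 : is_derive x 1 (fun u : R => u - h k) 1.
    by apply: is_derive_eq; rewrite subr0.
  have d4 := @is_derive1_comp R Phi (fun u => u - h k) _ _ _ d2 d3.
  have d5 := is_deriveM (is_deriveB d1 d4) (is_derive_cst (h k)^-1 x 1).
  apply: (is_derive_eq d5).
  by rewrite scaler0 add0r mulr1 /= /GRing.scale /= mulrC.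
(* By the mean value theorem the average is a value of f, which reduces convergence to uniform
   continuity. *)
have mean k x : a <= x -> exists2 y, x - h k <= y <= x & Psi k x = f y.
  move=> ax; have hk0 := h0 k; have hk1 := h1 k.
  have [|||y] := @MVT_segment R Phi f (x - h k) x; first by lra.
  - by move=> y; rewrite in_itv/= => /andP[yx _]; apply: dPhi; lra.
  - apply: derivable_within_continuous => y; rewrite in_itv/= => /andP[yx _].
    by apply: (@ex_derive _ _ _ _ _ _ _ (dPhi y _)); lra.
  - rewrite in_itv/= => yin e; exists y => //.
    by rewrite /Psi e opprB addrC subrK mulfK ?gt_eqF.
have prim k x : a <= x -> primL1 a (fk k) x = Psi k x.
  move=> ax.
  (* Psi k vanishes at a, being a value of f on [a - h k, a], where f is 0. *)
  have -> : Psi k x = Psi k x - Psi k a.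
    have [y yin ->] := mean k a (lexx a).
    by rewrite (f0 y) ?subr0//; case/andP : yin.
  rewrite /primL1 /integ /Rintegral.
  move: ax; rewrite le_eqVlt => /predU1P[<-|ax].
    by rewrite set_itv1 integral_set1 subrr.
  rewrite (@continuous_FTC2 _ _ (Psi k))//.
  - exact: continuous_subspaceT.
  - split=> [y|//|].
    + rewrite in_itv/= => /andP[ay _].
      by apply: (@ex_derive _ _ _ _ _ _ _ (dPsi k y _)); lra.
    + apply: cvg_at_right_filter.
      by apply: (is_derive1_continuous _ _ _ (dPsi k a _)); lra.
    + apply: cvg_at_left_filter.
      by apply: (is_derive1_continuous _ _ _ (dPsi k x _)); lra.
  - move=> y; rewrite in_itv/= => /andP[ay _].
    have ? : is_derive y 1 (Psi k) (fk k y) by apply: dPsi; lra.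
    by rewrite derive1E derive_val.
move=> eps eps0.
have [d d0 hd] := @Heine_segment f a b eps cf eps0.
have [N _ hN] : \forall k \near \oo, h k <= d.
  have /cvgrPdist_le/(_ _ d0) : h k @[k --> \oo] --> (0 : R) by exact: cvg_harmonic.
  by apply: filterS => k; rewrite sub0r normrN ger0_norm// ltW.
exists N => k Nk x xab; have /andP[ax xb] := xab.
rewrite prim// -(fE x)//.
have [y /andP[y1 y2] ->] := mean k x ax.
rewrite distrC; apply: hd => //.
have := hN k Nk; rewrite /= ler_norml; lra.
Qed.

End steklov_averages.

(** * Uniform convergence and continuity of fractional integrals *)

Section kernel_continuity.
Context {R : realType}.
Local Notation mu := (@lebesgue_measure R).
Implicit Types (a b x s : R) (f F : R -> R).

Lemma L1_sub a b x f : L1 a b f -> x <= b -> L1 a x f.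
Proof.
by move=> lf xb; apply: integrableS lf => //; apply: subset_itvl; rewrite bnd_simp.
Qed.

Lemma continuous_L1 a b f : {within `[a, b], continuous f} -> L1 a b f.
Proof. by move=> cf; apply: continuous_compact_integrable => //; exact: segment_compact. Qed.

Lemma L1_measurable a b f : L1 a b f -> measurable_fun `[a, b] f.
Proof. by case/integrableP => /measurable_EFinP. Qed.

Lemma continuous_primL1 a b f : a <= b -> L1 a b f ->
  {within `[a, b], continuous (primL1 a f)}.
Proof. by move=> ab lf; exact: parameterized_integral_continuous. Qed.

Lemma continuous_segment_bounded a b f : {within `[a, b], continuous f} ->
  exists M : R, forall t, a <= t <= b -> `|f t| <= M.
Proof.
move=> cf; have /compact_bounded[M [_ hM]] := continuous_compact cf (@segment_compact R a b).
exists (M + 1) => t tab; apply: (hM (M + 1)); first by rewrite ltrDl.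
by exists t => //; rewrite /= in_itv.
Qed.

(** Commutation turns the k-th primitive into K_s of J f_k, so [powint_bound] applies to J f_k - F;
    the constant C in the proof is the kernel mass over [a, b]. *)
Lemma primL1_powint_cvg a b s (fk : nat -> R -> R) F : a < b -> 0 < s ->
  {within `[a, b], continuous F} ->
  (forall k, L1 a b (fk k)) ->
  unif_cvg a b (fun k => primL1 a (fk k)) F ->
  unif_cvg a b (fun k => primL1 a (powint a s (fk k))) (powint a s F).
Proof.
move=> ab s0 cF lf cv e e0.
pose C := (b - a) `^ s / s.
have C0 : 0 < C by rewrite divr_gt0// powR_gt0// subr_gt0.
have [N hN] := cv _ (divr_gt0 e0 C0).
exists N => k Nk x xab; have /andP[ax xb] := xab.
have [_ ->] := @primL1_powint R a x s (fk k) s0 (L1_sub _ _ _ _ (lf k) xb).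
have cp := continuous_primL1 _ _ _ (ltW ab) (lf k).
have [M1 hM1] := continuous_segment_bounded _ _ _ cp.
have [M2 hM2] := continuous_segment_bounded _ _ _ cF.
have in_ab t : a <= t <= x -> a <= t <= b.
  by move=> /andP[-> tx] /=; exact: (le_trans tx xb).
have meas f : {within `[a, b], continuous f} -> measurable_fun `[a, x] f.
  by move=> cf; apply: (L1_measurable _ _ _ (L1_sub _ b _ _ _ xb)); exact: continuous_L1.
rewrite (@powintB R a x s M1 M2)//; last 4 first.
- exact: meas.
- by move=> t /in_ab; exact: hM1.
- exact: meas.
- by move=> t /in_ab; exact: hM2.
have := @powint_bound R a x s (e / C) (primL1 a (fk k) \- F) ax s0 _ _.
move=> /(_ _ _)/le_trans; apply.
- by apply: measurable_funB; exact: meas.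
- by move=> t /in_ab; exact: hN.
- rewrite -[leRHS](@divfK _ C)  ?gt_eqF//.
  apply: ler_wpM2l; first by rewrite divr_ge0 ?ltW.
  apply: ler_wpM2r; first by rewrite invr_ge0 ltW.
  by apply: ge0_ler_powR; rewrite ?nnegrE; move: s0 ax xb; lra.
Qed.

Lemma unif_cvg_continuous a b (G : nat -> R -> R) F :
  (forall k, {within `[a, b], continuous (G k)}) ->
  unif_cvg a b G F -> {within `[a, b], continuous F}.
Proof.
move=> cG cv; apply/subspace_continuousP => x xab.
apply/cvgrPdist_le => /= e e0.
have e30 : 0 < e / 3 by rewrite divr_gt0.
have [N hN] := cv _ e30.
have /subspace_continuousP/(_ x xab)/cvgrPdist_le/(_ _ e30) := cG N.
rewrite /= !near_withinE; apply: filterS => y /[swap] yab /(_ yab).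
have := hN N (leqnn N) x; have := hN N (leqnn N) y.
move: xab yab; rewrite /= !in_itv/= => xab yab /(_ yab) h1 /(_ xab) h2 h3.
have -> : F x - F y = (F x - G N x) + ((G N x - G N y) + (G N y - F y)) by ring.
rewrite (le_trans (ler_normD _ _))//.
rewrite distrC in h2.
have := ler_normD (G N x - G N y) (G N y - F y); lra.
Qed.

(** K_s F is the uniform limit of the functions J (K_s f_k), which are continuous as primitives of
    integrable functions; the singular kernel itself is never estimated pointwise. *)
Lemma continuous_powint a b s F : a < b -> 0 < s ->
  {within `[a, b], continuous F} -> F a = 0 ->
  {within `[a, b], continuous (powint a s F)}.
Proof.
move=> ab s0 cF Fa.
have [fk [lf cv]] := L1_dense_Alexiewicz a b F ab cF Fa.
have cv' := primL1_powint_cvg a b s fk F ab s0 cF lf cv.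
apply: (unif_cvg_continuous _ _ _ _ _ cv') => k.
apply: continuous_primL1; first exact: ltW.
by have [] := @primL1_powint R a b s (fk k) s0 (lf k).
Qed.

Lemma powint_lower a s F : powint a s F a = 0.
Proof. by rewrite /powint /integ set_itv1 Rintegral_set1. Qed.

Lemma primL1_lower a f : primL1 a f a = 0.
Proof. by rewrite /primL1 /integ set_itv1 Rintegral_set1. Qed.

Lemma primL1_Zl a b x c f : L1 a b f -> x <= b ->
  primL1 a (fun t => c * f t) x = c * primL1 a f x.
Proof. by move=> lf xb; rewrite -[RHS]RintegralZl//; exact: L1_sub lf xb. Qed.

Lemma unif_cvg_scale a b c (G : nat -> R -> R) F :
  unif_cvg a b G F -> unif_cvg a b (fun k x => c * G k x) (fun x => c * F x).
Proof.
move=> cv e e0.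
(* Adding 1 covers the case c = 0. *)
have c0 : 0 < `|c| + 1 by rewrite ltr_wpDl.
have [N hN] := cv _ (divr_gt0 e0 c0).
exists N => k Nk x xab; have := hN k Nk x xab.
rewrite ler_pdivlMr// -mulrBr normrM => h; apply: le_trans h.
by rewrite mulrC ler_wpM2l// lerDl.
Qed.

Lemma unif_cvg_unique a b (G : nat -> R -> R) F1 F2 :
  unif_cvg a b G F1 -> unif_cvg a b G F2 -> forall x, a <= x <= b -> F1 x = F2 x.
Proof.
move=> cv1 cv2 x xab; apply/eqP; rewrite -subr_eq0 -normr_le0.
apply/ler_addgt0Pl => e e0; rewrite addr0.
have e20 : 0 < e / 2 by rewrite divr_gt0.
have [N1 h1] := cv1 _ e20; have [N2 h2] := cv2 _ e20.
have := h1 _ (leq_maxl N1 N2) x xab; have := h2 _ (leq_maxr N1 N2) x xab.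
have := ler_distD (G (maxn N1 N2) x) (F1 x) (F2 x).
by rewrite (distrC (F1 x) (G _ x)); lra.
Qed.

End kernel_continuity.

(** * Smooth functions of compact support *)

Section bump_functions.
Context {R : realType}.
Local Notation mu := (@lebesgue_measure R).
Implicit Types (a b c d x s : R) (f g F : R -> R) (p : {poly R}).

Lemma derive1_is_derive f x df : is_derive x 1 f df -> f^`()%classic x = df.
Proof. by move=> h; rewrite derive1E derive_val. Qed.

Lemma is_derive_derivable f x df : is_derive x 1 f df -> derivable f x 1.
Proof. by case. Qed.

Lemma derivable_is_derive1 f x : derivable f x 1 -> is_derive x 1 f (f^`()%classic x).
Proof. by move=> h; split=> //; rewrite derive1E. Qed.

(** The difference quotient at x is at most K |h|. This handles the end points of the support of a
    bump. *)
Lemma is_derive0_quadratic f x (K : R) :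
  (forall y, `|f y| <= K * (y - x) ^+ 2) -> is_derive x 1 f 0.
Proof.
move=> fK.
have fx : f x = 0.
  by apply/eqP; rewrite -normr_le0; have := fK x; rewrite subrr expr0n mulr0.
have K0 : 0 <= K.
  by have := fK (x + 1); rewrite addrAC subrr add0r expr1n mulr1; apply: le_trans.
have cv : (fun h => h^-1 *: ((f \o shift x) (h *: 1) - f x)) @ 0^' --> (0 : R).
  apply/cvgrPdist_le => /= e e0; near=> h.
  have h0 : h != 0 by near: h; exact: nbhs_dnbhs_neq.
  have hK : `|h| <= e / (K + 1).
    by near: h; apply: dnbhs0_le; rewrite divr_gt0// ltr_wpDl.
  rewrite sub0r normrN fx subr0 /= /GRing.scale /= mulr1 normrM normfV.
  rewrite ler_pdivrMl ?normr_gt0//.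
  apply: (le_trans (fK _)); rewrite addrK.
  rewrite ler_pdivlMr ?ltr_wpDl// in hK.
  have -> : h ^+ 2 = `|h| * `|h| by rewrite -expr2 real_normK// num_real.
  rewrite mulrCA ler_wpM2l//.
  by apply: le_trans hK; rewrite mulrDr mulr1 mulrC lerDl.
split; first by apply/cvg_ex; exists 0.
exact/cvg_lim.
Unshelve. all: by end_near. Qed.

(** The polynomial p and the exponent k make the family closed under differentiation; p = 1 and k =
    0 give the usual bump. *)
Definition bump c d p k x : R :=
  if c < x < d then p.[x] * (((x - c) * (d - x))^-1) ^+ k *
    expR (- ((x - c) * (d - x))^-1) else 0.

(* numerator of the derivative of p w^k exp(-w), w = ((x - c)(d - x))^-1,
   over the common factor w^(k+2) exp(-w) *)
Definition bump_next c d p k : {poly R} :=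
  let q := ('X - c%:P) * (d%:P - 'X) in
  p^`() * q ^+ 2 + p * q^`() * (1 - k%:R *: q).

Lemma is_derive_bump_in c d p k x : c < x < d ->
  is_derive x 1 (bump c d p k) (bump c d (bump_next c d p k) k.+2 x).
Proof.
move=> cxd; have /andP[cx xd] := cxd.
pose q := ('X - c%:P) * (d%:P - 'X).
have qE y : (y - c) * (d - y) = q.[y] by rewrite /q !hornerE.
have q0 : q.[x] != 0 by rewrite -qE mulf_neq0// subr_eq0 ?gt_eqF.
have dpoly (r : {poly R}) (y : R) : is_derive y 1 (horner r) (r^`()).[y].
  by split; [exact: derivable_horner|rewrite -derive1E -derivE].
pose w (y : R) := (q.[y])^-1.
have dw : is_derive x 1 w (- (w x) ^+ 2 * (q^`()).[x]).
  by have := @is_deriveV R _ x _ 1 q0 (dpoly q x); rewrite /GRing.scale /= exprVn.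
have dwk := is_deriveX k dw.
have de : is_derive x 1 (fun y => expR (- w y)) (expR (- w x) * (- (- (w x) ^+ 2 * (q^`()).[x]))).
  exact: (@is_derive1_comp R expR (fun y => - w y) _ _ _ (is_derive_expR _) (is_deriveN dw)).
have dtot := is_deriveM (is_deriveM (dpoly p x) dwk) de.
apply: (near_eq_is_derive _ (is_derive_eq dtot _)).
  have : \forall y \near x, c < y < d.
    have := @near_in_itvoo R c d x; rewrite in_itv/= => /(_ cxd).
    by apply: filterS => y; rewrite in_itv.
  by apply: filterS => y cyd; rewrite /bump cyd qE mulrfctE exprfctE.
have qw : q.[x] * w x = 1 by rewrite mulfV.
(* For k = 0 the truncated [k.-1] is 0, and the factor k makes both sides vanish. *)
have kw : k%:R * w x ^+ k.-1 * w x = k%:R * w x ^+ k.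
  by case: (k) => [|l]; rewrite ?mul0r// -mulrA -exprSr.
rewrite /bump cxd qE -/(w x) /bump_next -/q mulrfctE exprfctE /GRing.scale /=.
move: (w x) (q^`()) qw kw => W q' qw kw; clear -qw kw; clearbody q.
rewrite hornerD !hornerM hornerD hornerN hornerZ hornerC.
move: (expR _) => E.
transitivity ((p^`().[x] * (q.[x] * W) ^+ 2 + p.[x] * q'.[x] *
    (W ^+ 2 - k%:R * (q.[x] * W) * W)) * W ^+ k * E); last by rewrite !exprS; ring.
rewrite qw expr1n !mulr1.
transitivity (E * (p.[x] * q'.[x] * (W ^+ 2 * W ^+ k - (k%:R * W ^+ k.-1 * W) * W) +
  W ^+ k * p^`().[x])); first by rewrite !exprS; ring.
by rewrite kw; ring.
Qed.

(* w^(k+2) <= (k+2)! exp w gives the bound (k+2)! ((x - c)(d - x))^2 *)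
Lemma bump_bound c d p k : exists K : R,
  forall x, `|bump c d p k x| <= K * (x - c) ^+ 2 /\ `|bump c d p k x| <= K * (d - x) ^+ 2.
Proof.
have [M hM] := continuous_segment_bounded c d _
  (@continuous_subspaceT _ _ _ _ (@continuous_horner R p)).
(* In each estimate one of the squares (x - c)^2 and (d - x)^2 is bounded by (d - c)^2 and absorbed
   into K. *)
pose K := `|M| * (k.+2)`!%:R * (d - c) ^+ 2.
have K0 : 0 <= K by rewrite mulr_ge0 ?sqr_ge0// mulr_ge0.
exists K => x; rewrite /bump; case: ifP => [/andP[cx xd]|_]; last first.
  by split; rewrite normr0 mulr_ge0 ?sqr_ge0.
pose q := (x - c) * (d - x); rewrite -/q.
have q0 : 0 < q by rewrite mulr_gt0// subr_gt0.
have w0 : 0 < q^-1 by rewrite invr_gt0.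
have f0 : 0 < (k.+2)`!%:R :> R by rewrite ltr0n fact_gt0.
have h : q^-1 ^+ k * expR (- q^-1) <= (k.+2)`!%:R * q ^+ 2.
  have h1 := expR_ge1Dxn k.+1 (ltW w0).
  have h2 : q^-1 ^+ k.+2 / (k.+2)`!%:R <= expR q^-1 by apply: le_trans h1; rewrite lerDr.
  rewrite ler_pdivrMr// in h2.
  rewrite expRN ler_pdivrMr ?expR_gt0//.
  have -> : q^-1 ^+ k = q ^+ 2 * q^-1 ^+ k.+2.
    by rewrite !exprS; field; rewrite gt_eqF.
  apply: (le_trans (ler_wpM2l (sqr_ge0 q) h2)).
  by rewrite le_eqVlt; apply/orP; left; apply/eqP; ring.
have hp : `|p.[x] * q^-1 ^+ k * expR (- q^-1)| <= `|M| * ((k.+2)`!%:R * q ^+ 2).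
  rewrite -mulrA normrM ler_pM//.
    apply: (le_trans (hM x _)); last exact: ler_norm.
    by rewrite (ltW cx) (ltW xd).
  by rewrite ger0_norm// mulr_ge0 ?expR_ge0// exprn_ge0// ltW.
have sq (u v : R) : 0 <= u -> u <= v -> u ^+ 2 <= v ^+ 2.
  by move=> u0 uv; rewrite lerXn2r ?nnegrE// (le_trans u0).
have pre u : 0 <= `|M| * (k.+2)`!%:R * u ^+ 2 by rewrite mulr_ge0 ?sqr_ge0// mulr_ge0.
split; apply: (le_trans hp); rewrite /K /q exprMn.
- have e : (d - x) ^+ 2 <= (d - c) ^+ 2 by apply: sq; move: cx xd; lra.
  have := ler_wpM2l (pre (x - c)) e; congr (_ <= _); ring.
- have e : (x - c) ^+ 2 <= (d - c) ^+ 2 by apply: sq; move: cx xd; lra.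
  have := ler_wpM2l (pre (d - x)) e; congr (_ <= _); ring.
Qed.

(** Inside ]c, d[ the explicit computation applies, away from the closed interval the function is
    locally 0, and at c and d the quadratic bound forces derivative 0. *)
Lemma is_derive_bump c d p k x :
  is_derive x 1 (bump c d p k) (bump c d (bump_next c d p k) k.+2 x).
Proof.
have [cxd|] := boolP (c < x < d); first exact: is_derive_bump_in.
rewrite {2}/bump => ncxd; rewrite (negbTE ncxd).
have [K hK] := bump_bound c d p k.
have zero_near y : (\forall z \near y, ~~ (c < z < d)) -> is_derive y 1 (bump c d p k) 0.
  move=> hy; apply: near_eq_is_derive (is_derive_cst 0 y 1).
  by apply: filterS hy => z; rewrite /bump => /negbTE ->.
have [xc|cx|->] := ltgtP x c.
- apply: zero_near; have := lt_nbhsl xc; apply: filterS => z zc.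
  by rewrite negb_and -leNgt (ltW zc).
- have [xd|dx|->] := ltgtP x d.
  + by move: ncxd; rewrite cx xd.
  + apply: zero_near; have := lt_nbhsr dx; apply: filterS => z dz.
    by rewrite negb_and orbC -leNgt (ltW dz).
  + apply: (@is_derive0_quadratic _ _ K) => y.
    by rewrite -sqrrN opprB; have [_] := hK y.
- by apply: (@is_derive0_quadratic _ _ K) => y; have [] := hK y.
Qed.

(** The induction runs over all p and k at once, since each differentiation changes both. *)
Lemma smooth_bump c d p k : smooth (bump c d p k).
Proof.
move=> n; elim: n p k => [|n IHn] p k x.
  exact: is_derive_derivable (is_derive_bump _ _ _ _ _).
rewrite derive1Sn.
suff -> : (bump c d p k)^`()%classic = bump c d (bump_next c d p k) k.+2 by exact: IHn.
by apply/funext => y; apply: derive1_is_derive; exact: is_derive_bump.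
Qed.

Lemma test_fun_bump a b c d p k : a < c -> d < b -> test_fun a b (bump c d p k).
Proof.
move=> ac db; split; first exact: smooth_bump.
exists c, d; split=> // x; rewrite /bump => -[xc|dx].
  by rewrite (lt_gtF xc).
by rewrite (lt_gtF dx) andbF.
Qed.

End bump_functions.

(** * Test functions and regular distributions *)

Section test_functions.
Context {R : realType}.
Local Notation mu := (@lebesgue_measure R).
Implicit Types (a b c d x s : R) (f g F phi psi : R -> R).

Lemma smooth_derive1n k phi : smooth phi -> smooth (derive1n k phi).
Proof.
move=> sphi n x; have := sphi (n + k)%N x.
by rewrite /derive1n iterD.
Qed.

Lemma smooth_continuous phi : smooth phi -> continuous phi.
Proof.
move=> sphi x; apply: differentiable_continuous; apply/derivable1_diffP.
exact: (sphi 0%N x).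
Qed.

Lemma derive1n_lin k (c : R) phi psi : smooth phi -> smooth psi ->
  derive1n k (fun x => c * phi x + psi x) =
  fun x => c * derive1n k phi x + derive1n k psi x.
Proof.
move=> sphi spsi; elim: k => // k IHk; rewrite derive1nS IHk; apply/funext => x.
have d1 := derivable_is_derive1 _ _ (sphi k x).
have d2 := derivable_is_derive1 _ _ (spsi k x).
by apply: derive1_is_derive; exact: is_deriveD (is_deriveZ c d1) d2.
Qed.

Lemma smooth_lin (c : R) phi psi : smooth phi -> smooth psi ->
  smooth (fun x => c * phi x + psi x).
Proof.
move=> sphi spsi k x; rewrite derive1n_lin//.
have d1 := derivable_is_derive1 _ _ (sphi k x).
have d2 := derivable_is_derive1 _ _ (spsi k x).
exact: is_derive_derivable (is_deriveD (is_deriveZ c d1) d2).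
Qed.

(** Near a point of an open set the derivative sees only that set; hence supports do not grow under
    differentiation. *)
Lemma derive1n_locally0 (U : set R) phi : open U -> (forall x, U x -> phi x = 0) ->
  forall k x, U x -> derive1n k phi x = 0.
Proof.
move=> oU phi0; elim=> // k IHk x Ux.
rewrite derive1nS; apply: derive1_is_derive.
apply: near_eq_is_derive (is_derive_cst 0 x 1).
have : nbhs x U by exact: open_nbhs_nbhs.
by apply: filterS => y Uy; rewrite IHk.
Qed.

Lemma test_fun_derive1n a b k phi : test_fun a b phi -> test_fun a b (derive1n k phi).
Proof.
move=> [sphi [c [d [ac db phi0]]]]; split; first exact: smooth_derive1n.
exists c, d; split=> // x [xc|dx].
- apply: (derive1n_locally0 `]-oo, c[%classic) => //.
  + by move=> y; rewrite /= in_itv/= => yc; apply: phi0; left.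
- apply: (derive1n_locally0 `]d, +oo[%classic) => //.
  + by move=> y; rewrite /= in_itv/= andbT => dy; apply: phi0; right.
  + by rewrite /= in_itv/= andbT.

Qed.

Lemma test_fun_lin a b (c : R) phi psi : test_fun a b phi -> test_fun a b psi ->
  test_fun a b (fun x => c * phi x + psi x).
Proof.
move=> [sphi [c1 [d1 [ac1 db1 phi0]]]] [spsi [c2 [d2 [ac2 db2 psi0]]]].
split; first exact: smooth_lin.
exists (Num.min c1 c2), (Num.max d1 d2); split.
- by rewrite lt_min ac1.
- by rewrite gt_max db1.
- move=> x; rewrite lt_min gt_max => h.
  rewrite phi0 ?psi0 ?mulr0 ?addr0//; by case: h => /andP[]; [left|right].
Qed.

Lemma continuousM_within a b f g : {within `[a, b], continuous f} ->
  {within `[a, b], continuous g} -> {within `[a, b], continuous (fun x => f x * g x)}.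
Proof. by move=> cf cg x; apply: continuousM; [exact: cf|exact: cg]. Qed.

Lemma integ_oo_cc a b f : L1 a b f -> integ `]a, b[ f = integ `[a, b] f.
Proof.
move=> lf; rewrite /integ Rintegral_itv_bndo_bndc ?Rintegral_itv_obnd_cbnd//.
  by apply: integrableS lf => //; exact: subset_itv_oc_cc.
by apply: integrableS lf => //; exact: subset_itv_oo_cc.
Qed.

Lemma reg_L1 a b f phi : {within `[a, b], continuous f} -> continuous phi ->
  L1 a b (fun x => f x * phi x).
Proof.
move=> cf cphi; apply: continuous_L1; apply: continuousM_within => //.
exact: continuous_subspaceT.
Qed.

Lemma regE a b f phi : {within `[a, b], continuous f} -> continuous phi ->
  reg a b f phi = integ `[a, b] (fun x => f x * phi x).
Proof. by move=> cf cphi; rewrite /reg integ_oo_cc//; exact: reg_L1. Qed.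

Lemma eq_reg a b f g : (forall x, a <= x <= b -> f x = g x) -> reg a b f = reg a b g.
Proof.
move=> fg; apply/funext => phi; apply: eq_Rintegral => x.
by rewrite inE/= in_itv/= => /andP[ax xb]; rewrite fg// !ltW.
Qed.

Lemma primL1_derive a b f x : L1 a b f -> a < x < b -> {for x, continuous f} ->
  is_derive x 1 (primL1 a f) (f x).
Proof.
move=> lf /andP[ax xb] cf.
have [d1 d2] := @continuous_FTC1_closed R f a x b xb lf ax cf.
by apply: DeriveDef; [exact: d1|rewrite -derive1E; exact: d2].
Qed.

(** Integration by parts; the boundary terms vanish because phi is 0 at a and b. *)
Lemma Dd_reg_primL1 a b f phi : a < b -> {within `[a, b], continuous f} ->
  test_fun a b phi -> Dd (reg a b (primL1 a f)) phi = reg a b f phi.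
Proof.
move=> ab cf tphi; have [sphi [c [d [ac db phi0]]]] := tphi.
have lf := continuous_L1 _ _ _ cf.
have cP := continuous_primL1 _ _ _ (ltW ab) lf.
have /continuous_within_itvP-/(_ ab)[cfin _ _] := cf.
have /continuous_within_itvP-/(_ ab)[_ cPa cPb] := cP.
have dP x : x \in `]a, b[ -> is_derive x 1 (primL1 a f) (f x).
  move=> xab; have axb : a < x < b by move: xab; rewrite in_itv.
  exact: (primL1_derive _ _ _ _ lf axb (cfin x xab)).
have cphi := smooth_continuous _ sphi.
have cphi' := smooth_continuous _ (smooth_derive1n 1 _ sphi).
rewrite /Dd !regE//.
rewrite /integ (@Rintegration_by_parts R (primL1 a f) phi f (phi^`()%classic))//.
- by rewrite !phi0 ?mulr0 ?subr0 ?sub0r ?opprK//; [left|right].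
- split=> //.
  by move=> x /dP; exact: is_derive_derivable.
- by move=> x /dP; exact: derive1_is_derive.
- exact: continuous_subspaceT.
- split=> [x _||]; first exact: (sphi 0%N).
  + exact/cvg_at_right_filter/cphi.
  + exact/cvg_at_left_filter/cphi.
Qed.

(** A continuous function is thus an element of D_HK, which gives meaning to its fractional
    integrals as distributions. *)
Lemma primitive_reg a b f : a < b -> {within `[a, b], continuous f} ->
  primitive a b (reg a b f) (primL1 a f).
Proof.
move=> ab cf; split; [|exact: primL1_lower|].
- by apply: continuous_primL1; [exact: ltW|exact: continuous_L1].
- by move=> phi tphi; exact: Dd_reg_primL1.
Qed.

Lemma eq_primitive a b T F G : (forall x, a <= x <= b -> F x = G x) -> a <= b ->
  primitive a b T F -> primitive a b T G.
Proof.
move=> FG ab [cF Fa eF]; split.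
- move: cF; apply: subspace_eq_continuous => x; rewrite mem_setE in_itv/=; exact: FG.
- by rewrite -FG// lexx.
- by rewrite -(eq_reg a b F G).
Qed.

(** The primitive of f is nondecreasing and is 0 at both ends, hence identically 0, and f x is its
    derivative. *)
Lemma integ_eq0_continuous a b f : a < b -> {within `[a, b], continuous f} ->
  (forall x, a <= x <= b -> 0 <= f x) -> integ `[a, b] f = 0 ->
  forall x, a < x < b -> f x = 0.
Proof.
move=> ab cf f0 if0 x xab.
have lf := continuous_L1 _ _ _ cf.
have /continuous_within_itvP-/(_ ab)[cfin _ _] := cf.
have xin : x \in `]a, b[ by rewrite in_itv.
have df : is_derive x 1 (primL1 a f) (f x) by exact: (primL1_derive _ _ _ _ lf xab (cfin x xin)).
rewrite -(derive1_is_derive _ _ _ df).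
apply: derive1_is_derive.
apply: near_eq_is_derive (is_derive_cst 0 x 1).
have := near_in_itvoo xin; apply: filterS => y; rewrite in_itv/= => /andP[ay yb].
apply/esym/eqP; rewrite eq_le; apply/andP; split; last first.
  apply: Rintegral_ge0 => t; rewrite /= in_itv/= => /andP[at_ ty].
  by apply: f0; rewrite at_ (le_trans ty)// ltW.
rewrite -if0 -subr_ge0 /primL1 /integ.
rewrite (Rintegral_itvB lf) ?bnd_simp; [|exact: ltW|exact: ltW].
apply: Rintegral_ge0 => t; rewrite /= in_itv/= => /andP[yt tb].
by apply: f0; rewrite tb andbT ltW// (lt_trans ay).
Qed.

End test_functions.

(** * The du Bois-Reymond lemma and uniqueness of primitives *)

Section du_bois_reymond.
Context {R : realType}.
Local Notation mu := (@lebesgue_measure R).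
Implicit Types (a b c d x s : R) (f g F phi psi : R -> R).

Lemma L1_Zl a b (k : R) f : L1 a b f -> L1 a b (fun x => k * f x).
Proof.
move=> lf; apply: (@eq_integrable _ _ _ mu _ (measurable_itv _)
  (fun x => (k%:E * (f x)%:E)%E)) => //.
exact: integrableZl.
Qed.

(** To the right of the support of phi the primitive equals the full integral, so the zero mean
    keeps its support compact in ]a, b[. *)
Lemma test_fun_primL1 a b phi : test_fun a b phi -> integ `[a, b] phi = 0 ->
  derive1n 1 (primL1 a phi) = phi /\ test_fun a b (primL1 a phi).
Proof.
move=> [sphi [c [d [ac db phi0]]]] iphi.
have cphi := smooth_continuous _ sphi.
have lo x : x < c -> primL1 a phi x = 0.
  move=> xc; rewrite /primL1 /integ /Rintegral integral0_eq// => t.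
  by rewrite /= in_itv/= => /andP[_ tx]; rewrite phi0//; left; apply: le_lt_trans xc.
have hi x : d < x -> primL1 a phi x = 0.
  move=> dx; rewrite -iphi /primL1 /integ Rintegral_mkcond [RHS]Rintegral_mkcond.
  apply: eq_Rintegral => t _; rewrite !patchE !mem_setE !in_itv/=.
  have [td|dt] := leP t d.
    by rewrite (le_trans td (ltW dx)) (le_trans td (ltW db)).
  by rewrite phi0 ?if_same//; right.
have dP x : is_derive x 1 (primL1 a phi) (phi x).
  have [cx|xc] := leP c x; first by apply: is_derive_integ => //; exact: lt_le_trans cx.
  rewrite phi0; last by left.
  apply: near_eq_is_derive (is_derive_cst 0 x 1).
  by have := lt_nbhsl xc; apply: filterS => y /lo ->.
have e : derive1n 1 (primL1 a phi) = phi.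
  by apply/funext => x; apply: derive1_is_derive.
split; first exact: e.
split; last by exists c, d; split; [| |move=> x [/lo|/hi]].
case=> [|k] x; first exact: is_derive_derivable (dP x).
by rewrite derive1Sn; move: e; rewrite derive1n1 => ->; exact: sphi.
Qed.

Lemma bump_ge0 c d x : 0 <= bump c d 1 0 x.
Proof.
rewrite /bump; case: ifP => // _.
by rewrite hornerC expr0 mulr1 mul1r expR_ge0.
Qed.

Lemma bump_gt0 c d x : c < x < d -> 0 < bump c d 1 0 x.
Proof. by move=> cxd; rewrite /bump cxd hornerC expr0 mulr1 mul1r expR_gt0. Qed.

(** If f x > 0, a bump supported where f stays positive gives a nonnegative product of integral 0
    that is positive at x. *)
Lemma fundamental_lemma_le0 a b f : a < b -> {within `[a, b], continuous f} ->
  (forall phi, test_fun a b phi -> integ `[a, b] (fun x => f x * phi x) = 0) ->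
  forall x, a < x < b -> f x <= 0.
Proof.
move=> ab cf h x xab; rewrite leNgt; apply/negP => fx0.
have /continuous_within_itvP-/(_ ab)[cfin _ _] := cf.
have xin : x \in `]a, b[ by rewrite in_itv.
have /cvgrPdist_lt/(_ _ fx0) : f y @[y --> x] --> f x by exact: cfin.
move=> /(filterI (near_in_itvoo xin)) [e /= e0 he].
(* Halving the minimum puts the closed support of the bump strictly inside ]a, b[ and inside the
   ball of radius e. *)
pose e' := Num.min e (Num.min (x - a) (b - x)) / 2.
have [axe [exb e'0]] : x - e' > a /\ x + e' < b /\ 0 < e' < e.
  have m0 : 0 < Num.min e (Num.min (x - a) (b - x)).
    by rewrite !lt_min e0 !subr_gt0.
  have : Num.min e (Num.min (x - a) (b - x)) <= e by rewrite ge_min lexx.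
  have : Num.min e (Num.min (x - a) (b - x)) <= x - a by rewrite !ge_min lexx orbT.
  have : Num.min e (Num.min (x - a) (b - x)) <= b - x by rewrite !ge_min lexx !orbT.
  by rewrite /e'; move: m0 fx0; move: (Num.min _ _) => m; lra.
have trho := @test_fun_bump R a b (x - e') (x + e') 1 0 axe exb.
have crho := smooth_continuous _ (smooth_bump (x - e') (x + e') 1 0).
have frho : (f x * bump (x - e') (x + e') 1 0 x)%R = 0.
  apply: (@integ_eq0_continuous R a b (fun y => f y * bump (x - e') (x + e') 1 0 y)) => //.
  - by apply: continuousM_within => //; exact: continuous_subspaceT.
  - move=> y _; rewrite /bump; case: ifP; rewrite ?mulr0// => ey.
    have /he [_] : ball x e y by rewrite /ball/= ltr_norml; move: ey e'0; lra.
    rewrite ltr_norml => /andP[_ h1]; apply: mulr_ge0; first by move: h1; lra.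
    by have := bump_ge0 (x - e') (x + e') y; rewrite /bump ey.
  - exact: h.
have : 0 < f x * bump (x - e') (x + e') 1 0 x.
  by rewrite mulr_gt0// bump_gt0//; move: e'0; lra.
by rewrite frho ltxx.
Qed.

Lemma fundamental_lemma a b f : a < b -> {within `[a, b], continuous f} ->
  (forall phi, test_fun a b phi -> integ `[a, b] (fun x => f x * phi x) = 0) ->
  forall x, a < x < b -> f x = 0.
Proof.
move=> ab cf h x xab; apply/eqP; rewrite eq_le (fundamental_lemma_le0 _ _ _ ab cf h)//=.
rewrite -oppr_le0.
apply: (@fundamental_lemma_le0 a b (fun y => - f y) ab) => //.
  by move=> y; apply: continuousN; exact: cf.
move=> phi tphi; have [sphi _] := tphi.
rewrite -[RHS](mulr0 (-1)) -(h _ tphi) -RintegralZl//.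
  by apply: eq_Rintegral => y _; rewrite mulN1r mulNr.
by apply: reg_L1 => //; exact: smooth_continuous.
Qed.

(** Correcting a test function by a multiple of a fixed bump makes its integral 0, hence makes it
    the derivative of a test function. So F minus a constant K annihilates every test function, F
    equals K inside, and continuity together with F a = 0 gives K = 0. *)
Lemma du_Bois_Reymond a b F : a < b -> {within `[a, b], continuous F} -> F a = 0 ->
  (forall phi, test_fun a b phi -> reg a b F (derive1n 1 phi) = 0) ->
  forall x, a <= x <= b -> F x = 0.
Proof.
move=> ab cF Fa h.
pose c := (2 * a + b) / 3; pose d := (a + 2 * b) / 3.
have [ac db cd] : [/\ a < c, d < b & c < d] by rewrite /c /d; split; move: ab; lra.
pose th := bump c d 1 0.
have tth : test_fun a b th by exact: test_fun_bump.
have cth := smooth_continuous _ tth.1.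
have Lth : L1 a b th by apply: continuous_L1; exact: continuous_subspaceT.
have ith : integ `[a, b] th != 0.
  apply/eqP => ith0.
  have [acd cdb] : a < (c + d) / 2 /\ (c + d) / 2 < b by move: ac db cd; lra.
  have : th ((c + d) / 2) = 0.
    apply: (@integ_eq0_continuous R a b th) => //; last by rewrite acd.
    - exact: continuous_subspaceT.
    - by move=> x _; exact: bump_ge0.
  by apply/eqP; rewrite gt_eqF// bump_gt0//; move: cd; lra.
(* The mean of F weighted by the bump is the only possible constant. *)
pose K := integ `[a, b] (fun x => F x * th x) / integ `[a, b] th.
have cFK : {within `[a, b], continuous (fun x => F x - K)}.
  apply: (@within_continuousB _ _ _ _ F (cst K)) => //.
  by apply: continuous_subspaceT; exact: cst_continuous.
have FK x : a < x < b -> F x - K = 0.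
  apply: (@fundamental_lemma a b (fun x => F x - K) ab cFK) => phi tphi.
  have cphi := smooth_continuous _ tphi.1.
  have Lphi : L1 a b phi by apply: continuous_L1; exact: continuous_subspaceT.
  pose k := - (integ `[a, b] phi / integ `[a, b] th).
  pose psi x := k * th x + phi x.
  have tpsi : test_fun a b psi by exact: test_fun_lin.
  have intlin f : {within `[a, b], continuous f} ->
      integ `[a, b] (fun x => f x * psi x) =
      k * integ `[a, b] (fun x => f x * th x) + integ `[a, b] (fun x => f x * phi x).
    move=> cf; have L1' := reg_L1 a b f th cf cth; have L2' := reg_L1 a b f phi cf cphi.
    rewrite -[X in X + _]RintegralZl// -[RHS]RintegralD//.
      by apply: eq_Rintegral => y _; rewrite /psi; ring.
    exact: L1_Zl.
  have ipsi : integ `[a, b] psi = 0.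
    rewrite [LHS](@RintegralD _ _ _ mu _ (fun x => k * th x) phi)//; last exact: L1_Zl.
    by rewrite [X in X + _]RintegralZl// /k mulNr divfK// addNr.
  have [e tp] := test_fun_primL1 _ _ _ tpsi ipsi.
  have := h _ tp; rewrite e regE//; last exact: smooth_continuous tpsi.1.
  rewrite intlin// => e0.
  transitivity (integ `[a, b] (fun x => F x * phi x) - K * integ `[a, b] phi).
    rewrite -[X in _ = _ - X]RintegralZl// -[RHS]RintegralB//.
    - by apply: eq_Rintegral => y _; rewrite mulrBl.
    - exact: reg_L1.
    - exact: L1_Zl.
  by rewrite -[RHS]e0 /K /k; ring.
have Foo x : a < x < b -> F x = K by move=> /FK/eqP; rewrite subr_eq0 => /eqP.
have /continuous_within_itvP-/(_ ab)[_ cFa cFb] := cF.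
have near_a : \forall x \near a^'+, F x = K.
  near=> x; apply: Foo; apply/andP; split; first by near: x; exact: nbhs_right_gt.
  by near: x; exact: nbhs_right_lt.
have near_b : \forall x \near b^'-, F x = K.
  near=> x; apply: Foo; apply/andP; split; last by near: x; exact: nbhs_left_lt.
  by near: x; exact: nbhs_left_gt.
have FaK : F a = K.
  apply: (cvg_unique _ cFa); first exact: Rhausdorff.
  by apply: cvg_near_cst.
have FbK : F b = K.
  apply: (cvg_unique _ cFb); first exact: Rhausdorff.
  by apply: cvg_near_cst.
move=> x /andP[]; rewrite le_eqVlt => /predU1P[<-//|ax].
rewrite le_eqVlt => /predU1P[->|xb]; first by rewrite FbK -FaK.
by rewrite Foo ?ax// -FaK.
Unshelve. all: by end_near. Qed.

(** The difference of two primitives annihilates derivatives of test functions. The quantifier over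
    all primitives in [isRL] therefore concerns a single function on [a, b]. *)
Lemma primitive_unique a b T F G : a < b -> primitive a b T F -> primitive a b T G ->
  forall x, a <= x <= b -> F x = G x.
Proof.
move=> ab [cF Fa hF] [cG Ga hG] x xab; apply/eqP; rewrite -subr_eq0; apply/eqP.
apply: (@du_Bois_Reymond a b (fun x => F x - G x) ab) => //.
- exact: (@within_continuousB _ _ _ _ F G).
- by rewrite Fa Ga subrr.
- move=> phi tphi.
  have [sphi' _] := test_fun_derive1n a b 1 phi tphi.
  have cphi' := smooth_continuous _ sphi'.
  have : Dd (reg a b F) phi = Dd (reg a b G) phi by rewrite hF// hG.
  rewrite /Dd => /oppr_inj e.
  rewrite regE//; last exact: (@within_continuousB _ _ _ _ F G).
  transitivity (reg a b F (derive1n 1 phi) - reg a b G (derive1n 1 phi)).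
    rewrite !regE// -[RHS]RintegralB//.
    - by apply: eq_Rintegral => y _; rewrite mulrBl.
    - exact: reg_L1.
    - exact: reg_L1.
  by rewrite e subrr.
Qed.

End du_bois_reymond.

(** * Fractional integrals of distributions *)

Section riemann_liouville.
Context {R : realType}.
Local Notation mu := (@lebesgue_measure R).
Implicit Types (a b c d x s n : R) (F G P : R -> R) (phi psi : R -> R).
Implicit Types (f T S : (R -> R) -> R).

Lemma DnE j T phi : Dn j T phi = (-1) ^+ j * T (derive1n j phi).
Proof.
elim: j phi => [|j IHj] phi; first by rewrite expr0 mul1r.
by rewrite [LHS]/(- Dn j T _) IHj exprS mulN1r mulNr [derive1n j.+1 _]derive1Sn.
Qed.

Lemma eqD_Dn a b j T S : eqD a b T S -> eqD a b (Dn j T) (Dn j S).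
Proof. by move=> TS phi tphi; rewrite !DnE TS//; exact: test_fun_derive1n. Qed.

Lemma L1_powint a b n (g : R -> R) : 0 < n -> L1 a b g -> L1 a b (powint a n g).
Proof. by move=> n0 lg; have [] := @primL1_powint R a b n g n0 lg. Qed.

Lemma primL1_RL_L1 a b n (g : R -> R) x : 0 < n -> L1 a b g -> x <= b ->
  primL1 a (RL_L1 a n g) x = RL_L1 a n (primL1 a g) x.
Proof.
move=> n0 lg xb.
rewrite [LHS](@primL1_Zl _ a b x _ (powint a n g))//; last exact: L1_powint.
by have [_ ->] := @primL1_powint R a x n g n0 (L1_sub _ _ _ _ lg xb).
Qed.

Lemma continuous_scale a b (k : R) F : {within `[a, b], continuous F} ->
  {within `[a, b], continuous (fun x => k * F x)}.
Proof.
by move=> cF; apply: continuousM_within => //; apply: continuous_subspaceT; exact: cst_continuous.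
Qed.

Lemma continuous_RL_L1 a b n F : a < b -> 0 < n ->
  {within `[a, b], continuous F} -> F a = 0 ->
  {within `[a, b], continuous (RL_L1 a n F)}.
Proof. by move=> ab n0 cF Fa; apply: continuous_scale; exact: continuous_powint. Qed.

Lemma RL_L1_cvg a b n (fk : nat -> R -> R) F : a < b -> 0 < n ->
  {within `[a, b], continuous F} -> (forall k, L1 a b (fk k)) ->
  unif_cvg a b (fun k => primL1 a (fk k)) F ->
  unif_cvg a b (fun k => primL1 a (RL_L1 a n (fk k))) (RL_L1 a n F).
Proof.
move=> ab n0 cF lf cv e e0.
have cvK := primL1_powint_cvg a b n fk F ab n0 cF lf cv.
have [N hN] := unif_cvg_scale a b (Gamma n)^-1 _ _ cvK e e0.
exists N => k Nk x xab; have /andP[_ xb] := xab.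
rewrite [primL1 _ _ _](@primL1_Zl _ a b x _ (powint a n (fk k)))//; first exact: hN.
exact: L1_powint.
Qed.

(** Density supplies one approximating sequence; along it the primitives tend both to the Q of the
    definition and to J^n P, so these agree. *)
Lemma isRL_frac_primitive a b n f T P : a < b -> 0 < n < 1 ->
  primitive a b f P -> isRL a b n f T -> primitive a b T (RL_L1 a n P).
Proof.
move=> ab /andP[n0 n1] pP /(_ P pP).
rewrite gt_eqF// leNgt n1/= => -[Q [pQ hQ]].
have [cP Pa _] := pP.
have [fk [lf cv]] := L1_dense_Alexiewicz a b P ab cP Pa.
apply: (eq_primitive _ _ _ Q) => //; last exact: ltW.
exact: (unif_cvg_unique a b _ _ _ (hQ fk lf cv) (RL_L1_cvg a b n fk P ab n0 cP lf cv)).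
Qed.

Lemma RL_HK_1 a P x : P a = 0 -> RL_HK_ge1 a 1 P x = (Gamma (1 : R))^-1 * P x.
Proof. by move=> Pa; rewrite /RL_HK_ge1 subrr !powRr0 Pa mul0r addr0 mulr0 subr0 mul1r. Qed.

(** Both boundary terms vanish, the one at x because n - 1 > 0, the one at a because P a = 0. *)
Lemma RL_HK_gt1 a n P x : 1 < n -> P a = 0 ->
  RL_HK_ge1 a n P x = ((Gamma n)^-1 * (n - 1)) * powint a (n - 1) P x.
Proof.
move=> n1 Pa; rewrite /RL_HK_ge1 powR0; last by rewrite subr_eq0 gt_eqF.
rewrite Pa mul0r mulr0 subr0 add0r mulrA /powint.
by have -> : n - 1 - 1 = n - 2 by ring.
Qed.

Lemma RL_HK_primL1 a b n F : a < b -> 1 <= n ->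
  {within `[a, b], continuous F} -> F a = 0 ->
  {within `[a, b], continuous (RL_HK_ge1 a n F)} /\
  forall x, a <= x <= b ->
    RL_HK_ge1 a n (primL1 a F) x = primL1 a (RL_HK_ge1 a n F) x.
Proof.
move=> ab + cF Fa; have lF := continuous_L1 _ _ _ cF.
rewrite le_eqVlt => /predU1P[<-|n1].
  have -> : RL_HK_ge1 a 1 F = fun x => (Gamma (1 : R))^-1 * F x.
    by apply/funext => x; exact: RL_HK_1.
  split=> [|x /andP[_ xb]]; first exact: continuous_scale.
  by rewrite RL_HK_1 ?primL1_lower// (primL1_Zl a b).
have n0 : 0 < n - 1 by rewrite subr_gt0.
have -> : RL_HK_ge1 a n F = fun x => ((Gamma n)^-1 * (n - 1)) * powint a (n - 1) F x.
  by apply/funext => x; exact: RL_HK_gt1.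
split=> [|x /andP[_ xb]].
  by apply: continuous_scale; exact: continuous_powint.
rewrite RL_HK_gt1 ?primL1_lower// (primL1_Zl a b)//; last exact: L1_powint.
by have [_ ->] := @primL1_powint R a x (n - 1) F n0 (L1_sub _ _ _ _ lF xb).
Qed.

(** The witnesses are f itself, the function given by the formula for n >= 1, and the derivative of
    J^n F; uniqueness carries them from F to any other primitive P. *)
Lemma isRL_exists a b n f F : a < b -> 0 <= n -> primitive a b f F ->
  exists T, isRL a b n f T.
Proof.
move=> ab n0 pF; have [cF Fa _] := pF.
have [->|nn0] := eqVneq n 0.
  by exists f => P pP; rewrite eqxx.
have n_gt0 : 0 < n by rewrite lt_def nn0.
have [n1|n1] := leP 1 n.
  exists (reg a b (RL_HK_ge1 a n F)) => P pP; rewrite (negbTE nn0) n1 => phi _.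
  apply: (congr1 (fun T => T phi)); apply: eq_reg => x /andP[ax xb].
  have PF := primitive_unique a b f F P ab pF pP.
  rewrite /RL_HK_ge1 !PF ?lexx ?(ltW ab) ?ax//.
  congr (_ * (_ + _ * _)); apply: eq_Rintegral => t.
  by rewrite inE/= in_itv/= => /andP[at_ tx]; rewrite PF// at_ (le_trans tx).
exists (Dd (reg a b (RL_L1 a n F))) => P pP; rewrite (negbTE nn0) leNgt n1/=.
exists (RL_L1 a n F); split.
  split=> //; first exact: continuous_RL_L1.
  by have := powint_lower a n F; rewrite /RL_L1 /powint => ->; rewrite mulr0.
move=> fk lf cv; apply: RL_L1_cvg => // e e0.
have [N hN] := cv e e0; exists N => k Nk x xab.
by rewrite (primitive_unique a b f F P ab pF pP)//; exact: hN.
Qed.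

(** The primitive of F is J F. For n = 0 the claim is DF = f. For n >= 1, T2 is J of the continuous
    function representing T1. For 0 < n < 1, T1 = D (J^n F), and T2 has primitive J^n (J F) = J (J^n
    F), so T2 = J^n F. *)
Lemma isRL_Dd a b n f F T1 T2 : a < b -> 0 <= n -> primitive a b f F ->
  isRL a b n f T1 -> isRL a b n (reg a b F) T2 -> eqD a b T1 (Dd T2).
Proof.
move=> ab n0 pF h1 h2 phi tphi; have [cF Fa fF] := pF.
have pG := primitive_reg a b F ab cF.
have tphi' := test_fun_derive1n a b 1 phi tphi.
have := h1 F pF; have := h2 _ pG.
case: eqP => [_ e2 e1|/eqP nn0].
  by rewrite e1// /Dd e2// -fF.
have n_gt0 : 0 < n by rewrite lt_def nn0.
case: leP => [n1 e2 e1|n1 _ _].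
  have [cR eR] := RL_HK_primL1 a b n F ab n1 cF Fa.
  by rewrite e1// /Dd e2// (eq_reg _ _ _ _ eR) -(Dd_reg_primL1 _ _ _ _ ab cR).
have n01 : 0 < n < 1 by rewrite n_gt0.
have [cR _ e1] := isRL_frac_primitive a b n f T1 F ab n01 pF h1.
have [_ _ e2] := isRL_frac_primitive a b n _ T2 _ ab n01 pG h2.
rewrite -e1// /Dd -e2//; congr (- _).
rewrite -(Dd_reg_primL1 _ _ _ _ ab cR)// /Dd; congr (- _).
congr (_ _); apply: eq_reg => x /andP[_ xb].
by apply: (primL1_RL_L1 a b) => //; exact: continuous_L1.
Qed.

Lemma ceiln_sub_itv n : 0 <= n -> 0 <= (ceiln n)%:R - n < 1.
Proof.
move=> n0; rewrite /ceiln.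
have c0 : 0 <= Num.ceil n by rewrite ceil_ge0//; apply: lt_le_trans n0; rewrite ltrN10.
(* The absolute value in [ceiln] is harmless, the ceiling being nonnegative. *)
have -> : (`|Num.ceil n|%N)%:R = (Num.ceil n)%:~R :> R.
  by rewrite -[in RHS](gez0_abs c0).
by have := @ceil_itv R n; rewrite intrB; lra.
Qed.

Lemma ceiln_frac n : 0 < n < 1 -> ceiln n = 1%N.
Proof. by move=> n01; rewrite /ceiln (@ceil_def _ _ 1)// subrr; move: n01; lra. Qed.

(** The pairing of Q over ]a, b[ with - phi' makes sense for every Schwartz function phi, and this
    is the extension. *)
Lemma temperate_primitive a b T Q : a < b -> primitive a b T Q -> temperate_on a b T.
Proof.
move=> ab [cQ _ eQ].
exists (Dd (reg a b Q)); split; last exact: eQ.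
have cder phi : schwartz phi -> continuous (derive1n 1 phi).
  by move=> [sphi _]; apply: smooth_continuous; exact: smooth_derive1n.
split.
  move=> phi psi c sphi spsi; rewrite /Dd derive1n_lin; [|exact: sphi.1|exact: spsi.1].
  have L1' := reg_L1 a b Q _ cQ (cder _ sphi).
  have L2' := reg_L1 a b Q _ cQ (cder _ spsi).
  rewrite mulrN -opprD; congr (- _).
  rewrite (@regE _ a b Q (fun x => c * derive1n 1 phi x + derive1n 1 psi x))//; last first.
    apply: smooth_continuous; apply: smooth_lin; apply: smooth_derive1n.
      exact: sphi.1.
    exact: spsi.1.
  rewrite !regE ?cder//; [|exact: cder|exact: cder].
  rewrite /integ -RintegralZl// -RintegralD//.
    by apply: eq_Rintegral => x _; ring.
  exact: L1_Zl.
have lQ := continuous_L1 _ _ _ cQ.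
(* The extension is bounded by the L^1 norm of Q times sup |phi'|, the seminorm with i = 0 and j =
   1. *)
exists (integ `[a, b] (fun x => `|Q x|)), 1%N => phi sphi M hM.
rewrite /Dd normrN regE//; last exact: cder.
have L1' := reg_L1 a b Q _ cQ (cder _ sphi).
apply: (le_trans (le_normr_Rintegral _ L1')) => //.
rewrite -RintegralZr//; last exact: (integrable_norm lQ).
apply: le_Rintegral => //.
- exact: (integrable_norm L1').
- apply: (@eq_integrable _ _ _ mu _ (measurable_itv _)
    (fun x => (M%:E * (`|Q x|)%:E)%E)) => //.
    by move=> x _; rewrite /= mulrC.
  by apply: integrableZl => //; exact: (integrable_norm lQ).
- move=> x _; rewrite normrM ler_wpM2l//.
  by have := hM 0%N 1%N x (leq0n _) (leqnn _); rewrite expr0 mul1r.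
Qed.

End riemann_liouville.

(** * Existence, commutation with D, and temperateness combined *)

Theorem theorem4p4 (R : realType) (a b n : R) (f : (R -> R) -> R) (F : R -> R)
  (hab : a < b) (hn : 0 <= n) (hF : primitive a b f F) :
  let m := ceiln n in
  (* the fractional integrals involved exist *)
  (exists T, isRL a b n f T) /\ (exists T, isRL a b n (reg a b F) T) /\
  (* J^n f = D (J^n F), and the pairing formula *)
  (forall T1 T2, isRL a b n f T1 -> isRL a b n (reg a b F) T2 ->
     eqD a b T1 (Dd T2) /\
     forall (j : nat) phi, test_fun a b phi ->
       Dn j T1 phi = (-1) ^+ j.+1 * T2 (derive1n j.+1 phi)) /\
  (* D^n f = D^(m+1) J^(m-n) F *)
  (exists T, isRLder a b n f T) /\
  (forall T3 T4, isRLder a b n f T3 -> isRL a b (m%:R - n) (reg a b F) T4 ->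
     eqD a b T3 (Dn m.+1 T4)) /\
  (* for 0 < n < 1: D^n F is temperate and equals J^(1-n) f *)
  (0 < n < 1 ->
     (exists T, isRLder a b n (reg a b F) T) /\
     forall T5 T6, isRLder a b n (reg a b F) T5 -> isRL a b (1 - n) f T6 ->
       temperate_on a b T5 /\ eqD a b T5 T6).
Proof.
have hm := ceiln_sub_itv n hn.
have m0 : 0 <= (ceiln n)%:R - n by case/andP: hm.
have [cF Fa fF] := hF.
have pG := primitive_reg a b F hab cF.
split; first exact: isRL_exists hF.
split; first exact: isRL_exists pG.
split.
  move=> T1 T2 h1 h2; have e := isRL_Dd a b n f F T1 T2 hab hn hF h1 h2.
  split=> // j phi tphi.
  rewrite DnE e; last exact: test_fun_derive1n.
  by rewrite /Dd mulrN exprS mulN1r mulNr.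
split.
  have [T' hT'] := isRL_exists a b _ f F hab m0 hF.
  by exists (Dn (ceiln n) T'), T'.
split.
  move=> T3 T4 [T' [h' e3]] h4 phi tphi.
  (* The extra derivative is taken innermost, where D T4 = J^(m-n) f. *)
  rewrite e3// /Dn iterSr.
  exact: (eqD_Dn a b _ _ _ (isRL_Dd a b _ f F T' T4 hab m0 hF h' h4)).
move=> n01; have /andP[n0 n1] := n01.
split.
  have [T' hT'] := isRL_exists a b _ _ _ hab m0 pG.
  by exists (Dn (ceiln n) T'), T'.
move=> T5 T6 [T' [h' e5]] h6.
have n01' : 0 < 1 - n < 1 by lra.
have hn' : 0 <= 1 - n by lra.
(* With m = 1, D^n F is D J^(1-n) F, which is J^(1-n) f by commutation at order 1 - n. *)
have c1 : ceiln n = 1%N by exact: ceiln_frac.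
rewrite c1 in h' e5.
have e6 : eqD a b T6 (Dd T') by exact: (isRL_Dd a b (1 - n) f F T6 T' hab hn' hF h6 h').
have e56 : eqD a b T5 T6.
  by move=> phi tphi; rewrite (e6 phi tphi); exact: (e5 phi tphi).
split; last exact: e56.
(* The continuous primitive J^(1-n) F of T6 also serves T5, which makes T5 temperate. *)
have [cQ Qa eQ] := isRL_frac_primitive a b _ f T6 F hab n01' hF h6.
apply: (temperate_primitive a b T5 _ hab).
split; [exact: cQ|exact: Qa|] => phi tphi.
by rewrite (e56 phi tphi); exact: eQ.
Qed.
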